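(* Let $N\ge1$, $1\le S\le N$, let $L=(L_1,\dots,L_S)$ be a band-width vector, let $\dot W$ be $L$-admissible and $W_\varepsilon=\mathrm{Id}+\varepsilon\dot W$, let $\beta\in\Gamma$, and let $\alpha\in\mathbb R^N$ be the $S$-banded vector with band vector $\beta$ and band-width vector $L$. Let $\mathcal P_\varepsilon$ be the associated transfer operator and fix $k\in\mathbb Z$. Then: (1) For all sufficiently small $\varepsilon>0$ (depending on $k$), $\mathcal P_\varepsilon$ has $N$ eigenfunctions of the form $F^{(\ell)}_{k,\varepsilon}(j,x)=f^{(\ell)}_{k,\varepsilon}(j)e^{2\pi i k x}$, $\ell=1,\dots,N$, whose eigenvalues $\lambda^{(1)}_{k,\varepsilon},\dots,\lambda^{(N)}_{k,\varepsilon}$ are pairwise distinct (these are the $N$ eigenvalues of $D_{k,\alpha}W_\varepsilon$, with $f^{(\ell)}_{k,\varepsilon}$ the corresponding eigenvectors). (2) These eigenvalues can be labelled so that $\lambda^{(\ell)}_{k,\varepsilon}\to e^{-2\pi i k\alpha_\ell}$ as $\varepsilon\to0$ for each $\ell$, and there exists an orthonormal basis $\{f^{(1)}_k,\dots,f^{(N)}_k\}$ of $\mathbb C^N$ such that, writing $F^{(\ell)}_k(j,x)=f^{(\ell)}_k(j)e^{2\pi i k x}$ and letting $\Pi^{(\ell)}_{k,\varepsilon}$, $\Pi^{(\ell)}_k:L^2(M)\to L^2(M)$ denote the $L^2$-orthogonal projections onto $\operatorname{span}\{F^{(\ell)}_{k,\varepsilon}\}$ and $\operatorname{span}\{F^{(\ell)}_k\}$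 respectively, we have $\Pi^{(\ell)}_{k,\varepsilon}\to\Pi^{(\ell)}_k$ in the $L^2(M)$ operator norm as $\varepsilon\to0$, for every $\ell$. Moreover: (a) if $S=1$ or $k=0$, $\{f^{(\ell)}_k\}_{\ell=1}^N$ is an orthonormal eigenbasis of $\dot W$; (b) if $S>1$ and $k\neq0$, $\{f^{(\ell)}_k\}_{\ell=1}^N$ is an orthonormal eigenbasis of $\hat P_{k,\beta,L}=D_{k,\beta,L}\hat W_L$, and for each $s\in\{1,\dots,S\}$ and each $\ell\in B_s$, the support of $f^{(\ell)}_k$ is contained in $B_s=\{N_{s-1}+1,\dots,N_s\}$.
   Context: $\mathbb S^1=\mathbb R/\mathbb Z$, $M=\{1,\dots,N\}\times\mathbb S^1$ with the product of the uniform probability on $\{1,\dots,N\}$ and Lebesgue measure; $L^2(M)$ is the complex $L^2$ space. For $\alpha\in\mathbb R^N$ and $\varepsilon\ge0$, $(\mathcal P_\varepsilon F)(j,x)=\sum_{j'=1}^N(W_\varepsilon)_{jj'}F(j',x-\alpha_j)$. For $k\in\mathbb Z$, $D_{k,\alpha}=\mathrm{Diag}(e^{-2\pi ik\alpha_1},\dots,e^{-2\pi ik\alpha_N})$. Band structure: a band-width vector is $L=(L_1,\dots,L_S)$ of positive integers with $\sum_s L_s=N$; set $N_0=0$, $N_s=N_{s-1}+L_s$, $B_s=\{j:N_{s-1}<j\le N_s\}$. Given distinct reals $\beta_1,\dots,\beta_S$ (the band vector), the $S$-banded vector $\alpha$ is defined by $\alpha_j=\beta_s$ for $j\in B_s$.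 Then $D_{k,\beta,L}:=D_{k,\alpha}$ is block diagonal with blocks $e^{-2\pi ik\beta_s}\mathrm{Id}_{L_s}$. $L$-admissible: $\dot W$ is a real symmetric $N\times N$ matrix such that (1) $\dot W_{ij}\ge0$ for $i\ne j$ and $\sum_j\dot W_{ij}=0$ for all $i$; (2) $\dot W$ has $N$ distinct eigenvalues; (3) for each $s$, the $L_s\times L_s$ submatrix $\hat W_s=(\dot W_{jk})_{j,k\in B_s}$ has $L_s$ distinct eigenvalues. $\hat W_L$ is the block-diagonal matrix with diagonal blocks $\hat W_1,\dots,\hat W_S$, and $\hat P_{k,\beta,L}=D_{k,\beta,L}\hat W_L$. $\Gamma=\{\beta\in\mathbb R^S: e^{-2\pi ik\beta_{s_1}}\neq e^{-2\pi ik\beta_{s_2}}\text{ for all }k\in\mathbb Z\setminus\{0\}\text{ and all }s_1\neq s_2\}$. *)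

(* Defs.v *)
From HB Require Import structures.
From mathcomp Require Import all_boot all_order all_algebra.
From mathcomp Require Import complex.
From mathcomp Require Import all_classical all_reals all_analysis.

Set Implicit Arguments.
Unset Strict Implicit.
Unset Printing Implicit Defensive.

Import Order.TTheory GRing.Theory Num.Theory.
Local Open Scope ring_scope.
Local Open Scope classical_set_scope.

Section Defs.
Variable R : realType.
Local Notation C := (R[i]).

Definition cabs (z : C) : R := Num.sqrt (complex.Re z ^+ 2 + complex.Im z ^+ 2).

Definition cexpi (t : R) : C := Complex (cos t) (sin t).

Definition RtoC (r : R) : C := Complex r 0.
Definition mxC (m n : nat) (A : 'M[R]_(m, n)) : 'M[C]_(m, n) := map_mx RtoC A.

(** ---------- band structure (0-based indices) ----------
   L : 'I_S -> nat is the band-width vector; block s (0-based) is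
   B_s = { j : N_s <= j < N_s + L_s } with N_s = sum_{t<s} L_t. *)
Definition bandstart (S : nat) (L : 'I_S -> nat) (s : 'I_S) : nat :=
  (\sum_(t < S | (t < s)%N) L t)%N.

Definition inB (S N : nat) (L : 'I_S -> nat) (s : 'I_S) (j : 'I_N) : bool :=
  (bandstart L s <= j < bandstart L s + L s)%N.

Definition bandwidth_vector (S : nat) (L : 'I_S -> nat) (N : nat) : Prop :=
  (forall s, (0 < L s)%N) /\ (\sum_(s < S) L s)%N = N.

Definition banded (S N : nat) (L : 'I_S -> nat) (beta : 'I_S -> R)
  (alpha : 'I_N -> R) : Prop :=
  forall (s : 'I_S) (j : 'I_N), inB L s j -> alpha j = beta s.

Definition blockmx (S N : nat) (L : 'I_S -> nat) (Wd : 'M[R]_N) (s : 'I_S)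
  : 'M[R]_(L s) :=
  \matrix_(a, b) \sum_(i : 'I_N | val i == (bandstart L s + a)%N)
                 \sum_(j : 'I_N | val j == (bandstart L s + b)%N) Wd i j.

Definition hatW (S N : nat) (L : 'I_S -> nat) (Wd : 'M[R]_N) : 'M[R]_N :=
  \matrix_(i, j) if [exists s, inB L s i && inB L s j] then Wd i j else 0.

Definition n_distinct_eigenvalues (n : nat) (A : 'M[R]_n) : Prop :=
  exists e : 'I_n -> R, injective e /\ forall i, eigenvalue A (e i).

Definition admissible (S N : nat) (L : 'I_S -> nat) (Wd : 'M[R]_N) : Prop :=
  [/\ Wd^T = Wd,
      (forall i j : 'I_N, i != j -> 0 <= Wd i j),
      (forall i : 'I_N, \sum_(j < N) Wd i j = 0),
      n_distinct_eigenvalues Wd &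
      forall s : 'I_S, n_distinct_eigenvalues (blockmx L Wd s)].

Definition ephase (k : int) (a : R) : C := cexpi (- (2 * pi * k%:~R * a)).

Definition inGamma (S : nat) (beta : 'I_S -> R) : Prop :=
  forall (k : int) (s1 s2 : 'I_S), k != 0 -> s1 != s2 ->
    ephase k (beta s1) != ephase k (beta s2).

Definition Dmx (N : nat) (k : int) (alpha : 'I_N -> R) : 'M[C]_N :=
  diag_mx (\row_j ephase k (alpha j)).

Definition Weps (N : nat) (Wd : 'M[R]_N) (eps : R) : 'M[R]_N :=
  1%:M + eps *: Wd.

(** ---------- functions on M = {1..N} x S^1 ----------
   A function on M is represented as G : 'I_N -> R -> C, the second
   variable being a 1-periodic real variable (S^1 = R/Z). *)

Definition Ptrans (N : nat) (alpha : 'I_N -> R) (W : 'M[R]_N)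
  (G : 'I_N -> R -> C) : 'I_N -> R -> C :=
  fun j x => \sum_(j' < N) RtoC (W j j') * G j' (x - alpha j).

Definition Ffun (N : nat) (k : int) (f : 'cV[C]_N) : 'I_N -> R -> C :=
  fun j x => f j ord0 * cexpi (2 * pi * k%:~R * x).

(** L^2(M): uniform probability on {1..N} times Lebesgue on [0,1] *)
Definition L2fun (N : nat) (G : 'I_N -> R -> C) : Prop :=
  forall j : 'I_N,
    [/\ measurable_fun (`[0%R, 1%R] : set R) (fun x => complex.Re (G j x)),
        measurable_fun (`[0%R, 1%R] : set R) (fun x => complex.Im (G j x)) &
        (\int[@lebesgue_measure R]_(x in (`[0%R, 1%R] : set R)) ((cabs (G j x)) ^+ 2)%:E
           < +oo)%E].

Definition L2norm (N : nat) (G : 'I_N -> R -> C) : R :=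
  Num.sqrt (N%:R^-1 * \sum_(j < N)
    Rintegral (@lebesgue_measure R) (`[0%R, 1%R] : set R) (fun x => (cabs (G j x)) ^+ 2)).

Definition L2inner (N : nat) (G F : 'I_N -> R -> C) : C :=
  RtoC (N%:R^-1) * \sum_(j < N)
    Complex (Rintegral (@lebesgue_measure R) (`[0%R, 1%R] : set R)
                (fun x => complex.Re (G j x * conjc (F j x))))
            (Rintegral (@lebesgue_measure R) (`[0%R, 1%R] : set R)
                (fun x => complex.Im (G j x * conjc (F j x)))).

Definition proj_span (N : nat) (F G : 'I_N -> R -> C) : 'I_N -> R -> C :=
  fun j x => (L2inner G F / L2inner F F) * F j x.

Definition proj_opnorm_cvg (N : nat) (Fe : R -> 'I_N -> R -> C)
  (F : 'I_N -> R -> C) : Prop :=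
  forall eta : R, 0 < eta -> exists delta : R, 0 < delta /\
    forall eps : R, 0 < eps < delta ->
      forall G : 'I_N -> R -> C, L2fun G ->
        L2norm (fun j x => proj_span (Fe eps) G j x - proj_span F G j x)
          <= eta * L2norm G.

Definition cvg0plus (z : R -> C) (c : C) : Prop :=
  forall eta : R, 0 < eta -> exists delta : R, 0 < delta /\
    forall eps : R, 0 < eps < delta -> cabs (z eps - c) < eta.

Definition cdot (N : nat) (u v : 'cV[C]_N) : C :=
  \sum_(j < N) u j ord0 * conjc (v j ord0).

Definition orthonormalC (N : nat) (f : 'I_N -> 'cV[C]_N) : Prop :=
  forall l m : 'I_N, cdot (f l) (f m) = (l == m)%:R.

Definition is_eigvec (N : nat) (A : 'M[C]_N) (v : 'cV[C]_N) : Prop :=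
  v != 0 /\ exists mu : C, A *m v = mu *: v.

End Defs.

(* Main.v *)
(* Conjugation by the modes e^{2 pi i k x} turns P_eps into D (1 + eps W), with
   D = D_{k,alpha}. Fix an orthonormal basis f_l of eigenvectors of the part of
   W that couples equal phases: W itself if all phases agree, its band-diagonal
   part otherwise. In this basis D stays diagonal and the coupling inside each
   eigenspace of D is diagonal with distinct entries mu_l. Writing an eigenvalue
   as d_l (1 + eps nu) and rescaling by sqrt eps the coordinates outside the
   eigenspace of d_l, the eigenvector equation becomes M(nu, sqrt eps) w = 0,
   where M is polynomial in both variables and M(nu, 0) is diagonal; mu_l is a
   simple root of det M(nu, 0). A root of det M(nu, sqrt eps) then lies within
   O(sqrt eps) of mu_l, and the kernel vector within O(sqrt eps) of the l-th
   basis vector. Finally, a projection on the span of f e^{2 pi i k x} only sees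
   the k-th Fourier coefficients, which Bessel's inequality bounds by the L2
   norm, so operator-norm convergence reduces to convergence in C^N. *)
Require Import Defs.
From HB Require Import structures.
From mathcomp Require Import all_boot all_order all_algebra.
From mathcomp Require Import complex.
From mathcomp Require Import all_classical all_reals all_analysis.
From mathcomp Require Import measurable_realfun ring lra.

Import Order.TTheory GRing.Theory Num.Theory.
Local Open Scope ring_scope.

Set Implicit Arguments.
Unset Strict Implicit.
Unset Printing Implicit Defensive.

(** * Real-valued modulus of complex numbers *)

Section ComplexModulus.
Variable R : realType.
Implicit Types z w : R[i].

Lemma cabs_normr z : `|z| = RtoC (cabs z).
Proof. by case: z. Qed.

Lemma cabs_ge0 z : 0 <= cabs z.
Proof. exact: sqrtr_ge0. Qed.

Lemma cabsM z w : cabs (z * w) = cabs z * cabs w.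
Proof. by have := ComplexField.Normc.normcM z w; case: z; case: w. Qed.

Lemma cabsV z : cabs z^-1 = (cabs z)^-1.
Proof. by have := ComplexField.Normc.normcV z; case: z. Qed.

Lemma cabs0 : cabs (0 : R[i]) = 0.
Proof. exact: (ComplexField.Normc.normc0 R). Qed.

Lemma cabs1 : cabs (1 : R[i]) = 1.
Proof. exact: (ComplexField.Normc.normc1 R). Qed.

Lemma cabs_eq0 z : (cabs z == 0) = (z == 0).
Proof.
apply/eqP/eqP => [|->]; last exact: cabs0.
by case: z => a b ?; exact: ComplexField.Normc.eq0_normc.
Qed.

Lemma cabs_gt0 z : (0 < cabs z) = (z != 0).
Proof. by rewrite lt_def cabs_ge0 andbT cabs_eq0. Qed.

Lemma cabsN z : cabs (- z) = cabs z.
Proof. by case: z => a b; rewrite /cabs /= !sqrrN. Qed.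

Lemma cabsB z w : cabs (z - w) = cabs (w - z).
Proof. by rewrite -cabsN opprB. Qed.

Lemma cabs_conj z : cabs (conjc z) = cabs z.
Proof. by case: z => a b; rewrite /cabs /= sqrrN. Qed.

Lemma cabsD z w : cabs (z + w) <= cabs z + cabs w.
Proof. by have := ler_normD z w; rewrite !cabs_normr lecE => /andP[_]. Qed.

Lemma cabs_sum (I : Type) (r : seq I) (P : pred I) (F : I -> R[i]) :
  cabs (\sum_(i <- r | P i) F i) <= \sum_(i <- r | P i) cabs (F i).
Proof.
elim/big_rec2: _ => [|i x y _ le_yx]; first by rewrite cabs0.
exact: le_trans (cabsD _ _) (lerD (lexx _) le_yx).
Qed.

Lemma cabs_RtoC (a : R) : cabs (RtoC a) = `|a|.
Proof. by rewrite /cabs /= expr0n addr0 sqrtr_sqr. Qed.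

Lemma cabs_sqr z : cabs z ^+ 2 = complex.Re z ^+ 2 + complex.Im z ^+ 2.
Proof. by rewrite sqr_sqrtr // addr_ge0 ?sqr_ge0. Qed.

Lemma mulc_conj z : z * conjc z = RtoC (cabs z ^+ 2).
Proof.
rewrite cabs_sqr; case: z => a b; apply/eqP.
by rewrite eq_complex /=; apply/andP; split; apply/eqP; ring.
Qed.

Lemma RtoCE : @RtoC R = real_complex R.
Proof. by []. Qed.

End ComplexModulus.

(** One plus the sum of the absolute values of finitely many constants dominates each of them, and
    [P] is monotone in its constant. *)
Lemma uniform_constant (R : realType) (I : finType) (P : I -> R -> Prop) :
  (forall i K K', K <= K' -> P i K -> P i K') ->
  (forall i, exists K, P i K) -> exists2 K, 0 < K & forall i, P i K.
Proof.
move=> Pmono /choice[K PK]; exists (1 + \sum_i `|K i|).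
  by rewrite ltr_pwDl // sumr_ge0.
move=> i; apply: Pmono (PK i).
rewrite (bigD1 i) //= (le_trans (ler_norm _)) // addrCA lerDl addr_ge0 //.
by rewrite sumr_ge0.
Qed.

(** * Locating a root of a polynomial near a given point *)

Section RootLocalization.
Variable R : realType.
Local Notation C := R[i].

Lemma deriv_prod_XsubC (r : seq C) (x : C) : x \notin r ->
  (\prod_(z <- r) ('X - z%:P))^`().[x] =
  (\prod_(z <- r) ('X - z%:P)).[x] * \sum_(z <- r) (x - z)^-1.
Proof.
elim: r => [|z r IHr]; first by rewrite !big_nil derivC horner0 mulr0.
rewrite inE negb_or => /andP[xz xr]; rewrite !big_cons derivM derivXsubC.
rewrite hornerD !hornerM hornerXsubC hornerC mul1r (IHr xr).
by move: xz; rewrite -subr_eq0 => xz; field.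
Qed.

(* The logarithmic derivative p'/p is the sum of the (x0 - z)^-1 over the
   roots z, so one of its terms is at least of size |p'/p| / deg p. *)
Lemma root_near (p : {poly C}) (x0 : C) : p^`().[x0] != 0 ->
  exists2 x, root p x &
    cabs (x - x0) * cabs p^`().[x0] <= (size p)%:R * cabs p.[x0].
Proof.
move=> dp0; have p_neq0 : p != 0.
  by apply: contraNneq dp0 => ->; rewrite linear0 horner0.
have [px0|px0] := eqVneq p.[x0] 0.
  by exists x0; [exact/rootP | rewrite px0 subrr !cabs0 mul0r mulr0].
have [r pE] := closed_field_poly_normal p.
have lc0 : lead_coef p != 0 by rewrite lead_coef_eq0.
have rootE z : root p z = (z \in r).
  by rewrite pE rootZ ?root_prod_XsubC.
have sz : size p = (size r).+1 by rewrite pE size_scale // size_prod_XsubC.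
have x0r : x0 \notin r by rewrite -rootE /root.
have dE : p^`().[x0] = p.[x0] * \sum_(z <- r) (x0 - z)^-1.
  by rewrite [in LHS]pE [in RHS]pE derivZ !hornerZ deriv_prod_XsubC // mulrA.
apply: contrapT => far.
have {}far z : z \in r -> cabs (x0 - z)^-1 <=
    cabs p^`().[x0] / ((size p)%:R * cabs p.[x0]).
  move=> zr; have xz : 0 < cabs (x0 - z).
    by rewrite cabs_gt0 subr_eq0; apply: contraNneq x0r => ->.
  rewrite cabsV ler_pdivlMr; last by rewrite mulr_gt0 ?cabs_gt0 // sz ltr0n.
  rewrite ler_pdivrMl // leNgt; apply/negP => lt_z; apply: far.
  by exists z; rewrite ?rootE // cabsB ltW // ltNge -leNgt.
have n_gt0 : 0 < (size p)%:R :> R by rewrite sz ltr0n.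
have px_gt0 : 0 < cabs p.[x0] by rewrite cabs_gt0.
have dp_gt0 : 0 < cabs p^`().[x0] by rewrite cabs_gt0.
(* Bounding each term of the logarithmic derivative produces the factor [size r / size p], which is
   below 1 because [size p] exceeds the number of roots by one: a contradiction. *)
have: cabs p^`().[x0] <=
    cabs p.[x0] * ((size r)%:R * (cabs p^`().[x0] / ((size p)%:R * cabs p.[x0]))).
  rewrite {1}dE cabsM ler_pM2l // (le_trans (cabs_sum _ _ _)) //.
  rewrite big_seq (le_trans (ler_sum _ far)) // -big_seq.
  by rewrite big_const_seq count_predT iter_addr_0 [leRHS]mulr_natl.
rewrite (_ : _ * _ = (size r)%:R / (size p)%:R * cabs p^`().[x0]); last first.
  have px_n0 := lt0r_neq0 px_gt0; have n_n0 := lt0r_neq0 n_gt0.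
  by field; rewrite px_n0 n_n0.
by rewrite ler_pMl // ler_pdivlMr // mul1r ler_nat sz ltnn.
Qed.

End RootLocalization.

(** * Perturbation of diagonal polynomial matrices *)

Section LocallyLipschitz.
Variable R : realType.
Local Notation C := R[i].

(** Only increments from the base point [(x0, 0)] are compared, within the unit bidisc around it;
    such bounds survive sums and products. *)
Definition lipschitz_near (g : C -> C -> C) (x0 : C) (K : R) : Prop :=
  forall x y, cabs (x - x0) <= 1 -> cabs y <= 1 ->
    cabs (g x y - g x0 0) <= K * (cabs (x - x0) + cabs y).

Lemma lipschitz_near_mono g x0 K K' :
  K <= K' -> lipschitz_near g x0 K -> lipschitz_near g x0 K'.
Proof.
move=> KK' lipg x y hx hy; apply: le_trans (lipg x y hx hy) _.
by rewrite ler_wpM2r // addr_ge0 ?cabs_ge0.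
Qed.

Lemma lipschitz_nearD g h x0 K K' :
  lipschitz_near g x0 K -> lipschitz_near h x0 K' ->
  lipschitz_near (fun x y => g x y + h x y) x0 (K + K').
Proof.
move=> lipg liph x y hx hy.
rewrite opprD addrACA (le_trans (cabsD _ _)) // mulrDl.
by rewrite lerD ?lipg ?liph.
Qed.

Lemma lipschitz_nearM g h x0 K K' : 0 <= K -> 0 <= K' ->
  lipschitz_near g x0 K -> lipschitz_near h x0 K' ->
  lipschitz_near (fun x y => g x y * h x y) x0
    (K * (cabs (h x0 0) + 2 * K') + cabs (g x0 0) * K').
Proof.
move=> K0 K'0 lipg liph x y hx hy.
have hg := lipg x y hx hy; have hh := liph x y hx hy.
have s0 : 0 <= cabs (x - x0) + cabs y by rewrite addr_ge0 ?cabs_ge0.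
have hb : cabs (h x y) <= cabs (h x0 0) + 2 * K'.
  rewrite -[h x y](subrK (h x0 0)) addrC (le_trans (cabsD _ _)) // lerD2l.
  by rewrite (le_trans hh) // mulrC ler_wpM2r // lerD.
rewrite (_ : _ - _ = (g x y - g x0 0) * h x y + g x0 0 * (h x y - h x0 0));
  last by ring.
rewrite (le_trans (cabsD _ _)) // !cabsM mulrDl lerD //.
  by rewrite mulrAC ler_pM ?cabs_ge0.
by rewrite -mulrA ler_wpM2l ?cabs_ge0.
Qed.

Lemma lipschitz_near_exM g h x0 :
  (exists2 K, 0 <= K & lipschitz_near g x0 K) ->
  (exists2 K, 0 <= K & lipschitz_near h x0 K) ->
  exists2 K, 0 <= K & lipschitz_near (fun x y => g x y * h x y) x0 K.
Proof.
move=> [K K0 hK] [K' K'0 hK']; exists (K * (cabs (h x0 0) + 2 * K') + cabs (g x0 0) * K').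
  by rewrite addr_ge0 ?mulr_ge0 ?addr_ge0 ?mulr_ge0 ?cabs_ge0.
exact: lipschitz_nearM.
Qed.

Lemma lipschitz_near_exD g h x0 :
  (exists2 K, 0 <= K & lipschitz_near g x0 K) ->
  (exists2 K, 0 <= K & lipschitz_near h x0 K) ->
  exists2 K, 0 <= K & lipschitz_near (fun x y => g x y + h x y) x0 K.
Proof.
move=> [K K0 hK] [K' K'0 hK']; exists (K + K'); first exact: addr_ge0.
exact: lipschitz_nearD.
Qed.

Lemma lipschitz_near_cst (a : C) x0 :
  exists2 K, 0 <= K & lipschitz_near (fun _ _ => a) x0 K.
Proof. by exists 0 => // x y _ _; rewrite subrr cabs0 mul0r. Qed.

(** Constants and both coordinate functions satisfy the bound, and Horner's scheme builds [Q] from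
    them by sums and products, first in the inner variable [y], then in the outer variable [x]. *)
Lemma bivariate_lipschitz (Q : {poly {poly C}}) (x0 : C) :
  exists2 K, 0 <= K & lipschitz_near (fun x y => Q.[x%:P].[y]) x0 K.
Proof.
pose lip g := exists2 K, 0 <= K & lipschitz_near g x0 K.
have ext g h : (forall x y, g x y = h x y) -> lip g -> lip h.
  by move=> gh [K K0 hK]; exists K => // x y; rewrite -!gh; exact: hK.
have lip_const (c : {poly C}) : lip (fun _ y => c.[y]).
  elim/poly_ind: c => [|c a IHc].
    by apply: ext (lipschitz_near_cst 0 x0) => x y; rewrite horner0.
  apply: (@ext (fun _ y => c.[y] * y + a)) => [x y|].
    by rewrite hornerMXaddC.
  apply: lipschitz_near_exD (lipschitz_near_cst a x0).
  apply: lipschitz_near_exM IHc _; exists 1 => // x y _ _.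
  by rewrite subr0 mul1r lerDr cabs_ge0.
elim/poly_ind: Q => [|Q c IHQ].
  by apply: ext (lipschitz_near_cst 0 x0) => x y; rewrite horner0 horner0.
apply: (@ext (fun x y => Q.[x%:P].[y] * x + c.[y])) => [x y|].
  by rewrite hornerMXaddC hornerD hornerM hornerC.
apply: lipschitz_near_exD (lip_const c).
apply: lipschitz_near_exM IHQ _; exists 1 => // x y _ _.
by rewrite mul1r lerDl cabs_ge0.
Qed.

End LocallyLipschitz.

(** * Root and kernel vector of a polynomial matrix that is diagonal at [y = 0] *)

Section SingularPerturbation.
Variable R : realType.
Local Notation C := R[i].
Variables (N : nat) (M : 'M[{poly {poly C}}]_N) (E : 'I_N -> {poly C}).
Variables (l : 'I_N) (x0 : C).
Hypothesis M_diag : forall i j,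
  map_poly (horner_eval 0) (M i j) = E i *+ (i == j).
Hypothesis E_root : root (E l) x0.
Hypothesis E_simple : (E l)^`().[x0] != 0.
Hypothesis E_others : forall j, j != l -> (E j).[x0] != 0.

Let Meval (x y : C) : 'M[C]_N := map_mx (fun q => q.[x%:P].[y]) M.

(** Specialising the inner variable first leaves, for fixed [y], a univariate polynomial in [x], to
    which [root_near] applies. *)
Let horner2 (q : {poly {poly C}}) (x y : C) :
  q.[x%:P].[y] = (map_poly (horner_eval y) q).[x].
Proof.
by rewrite -[x in RHS](hornerC x y) -[_.[y]]/(horner_eval y _) horner_map.
Qed.

Let detMeval x y : \det (Meval x y) = (\det M).[x%:P].[y].
Proof.
rewrite -[RHS]/((horner_eval y \o horner_eval x%:P) (\det M)) -det_map_mx.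
by congr (\det _); apply/matrixP => i j; rewrite !mxE.
Qed.

Let det_at0 : map_poly (horner_eval 0) (\det M) = \prod_i E i.
Proof.
rewrite -det_map_mx (_ : map_mx _ M = diag_mx (\row_i E i)).
  by rewrite det_diag; apply: eq_bigr => i _; rewrite mxE.
apply/matrixP => i j; rewrite [RHS]mxE [in RHS]mxE -M_diag; exact: mxE.
Qed.

(** For fixed [y], [root_near] is applied to the determinant at [x0]: its value there is [O(|y|)],
    since it vanishes at [y = 0], and its derivative stays close to the nonzero derivative of
    [\prod_i E i]. *)
Let det_root : exists2 K, 0 < K & forall y, K * cabs y < 1 ->
  exists2 x, \det (Meval x y) = 0 & cabs (x - x0) <= K * cabs y.
Proof.
set Q := \det M.
have [K1 K1_ge0 lip1] := bivariate_lipschitz Q x0.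
have [K2 K2_ge0 lip2] := bivariate_lipschitz Q^`() x0.
pose c := cabs (\prod_i E i)^`().[x0].
have q0 : Q.[x0%:P].[0] = 0.
  rewrite horner2 det_at0 horner_prod (bigD1 l) //=.
  by rewrite (rootP E_root) mul0r.
have q0' : cabs Q^`().[x0%:P].[0] = c.
  by rewrite horner2 -deriv_map det_at0.
(* At [x0] only the term differentiating [E l] survives; it is nonzero because that root is simple
   and the other factors do not vanish. *)
have c_gt0 : 0 < c.
  rewrite /c cabs_gt0 (bigD1 l) //= derivM hornerD !hornerM (rootP E_root).
  rewrite mul0r addr0 mulf_neq0 // horner_prod.
  by apply/prodf_neq0 => j; exact: E_others.
have c_ge0 := ltW c_gt0.
pose n : R := (size Q)%:R.
have n_ge0 : 0 <= n by rewrite ler0n.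
(* The condition [K * cabs y < 1] forces [cabs y <= 1] through the summand 1, and
   [2 * K2 * cabs y <= c], which keeps the derivative above [c / 2]; the root then moves by at most
   [2 * n * K1 / c * cabs y]. *)
pose K := 1 + 2 * (K2 + n * K1) / c.
have K_gt0 : 0 < K by rewrite ltr_pwDl // !mulr_ge0 ?addr_ge0 ?mulr_ge0 ?invr_ge0.
exists K => // y Ky.
have y_ge0 := cabs_ge0 y.
have Kc : K * c = c + 2 * (K2 + n * K1) by rewrite /K; field; rewrite gt_eqF.
have nK_ge0 : 0 <= n * K1 by rewrite mulr_ge0.
have y1 : cabs y <= 1.
  have : cabs y <= K * cabs y.
    by rewrite ler_peMl // lerDl !mulr_ge0 ?addr_ge0 ?mulr_ge0 ?invr_ge0.
  by move/le_trans; apply; exact: ltW.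
have lipy (P : {poly {poly C}}) L : lipschitz_near (fun x y => P.[x%:P].[y]) x0 L ->
    cabs (P.[x0%:P].[y] - P.[x0%:P].[0]) <= L * cabs y.
  by move=> /(_ x0 y); rewrite subrr cabs0 add0r; apply.
have h1 : cabs Q.[x0%:P].[y] <= K1 * cabs y.
  by have := lipy _ _ lip1; rewrite q0 subr0.
have h2 : c / 2 <= cabs Q^`().[x0%:P].[y].
  have h := lipy _ _ lip2; rewrite cabsB in h.
  have := cabsD (Q^`().[x0%:P].[0] - Q^`().[x0%:P].[y]) Q^`().[x0%:P].[y].
  rewrite subrK q0'.
  have : K2 * cabs y * 2 <= c.
    have : K * c * cabs y <= c by rewrite mulrAC ler_piMl // ltW.
    rewrite Kc => /(le_trans _); apply.
    have -> : (c + 2 * (K2 + n * K1)) * cabs y =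
       c * cabs y + K2 * cabs y * 2 + 2 * (n * K1) * cabs y by ring.
    by rewrite -addrA addrCA lerDl addr_ge0 // !mulr_ge0.
  lra.
have [|x /rootP rx hx] := @root_near R (map_poly (horner_eval y) Q) x0.
  rewrite deriv_map -horner2 -cabs_gt0 (lt_le_trans _ h2) //.
  by rewrite divr_gt0.
exists x; first by rewrite detMeval horner2.
rewrite deriv_map -!horner2 in hx.
have sz : (size (map_poly (horner_eval y) Q))%:R <= n.
  by rewrite ler_nat size_poly.
have : cabs (x - x0) * (c / 2) <= n * (K1 * cabs y).
  apply: le_trans (ler_wpM2l (cabs_ge0 _) h2) _; apply: le_trans hx _.
  by rewrite ler_pM ?cabs_ge0.
move=> hxc; rewrite -(ler_pM2r c_gt0) [K * _ * _]mulrAC Kc.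
have : 0 <= c * cabs y by rewrite mulr_ge0.
have : 0 <= K2 * cabs y by rewrite mulr_ge0.
move: hxc; lra.
Qed.

(** Comparing row [j] of the kernel equation with the diagonal row at [(x0, 0)] expresses [(E
    j).[x0] * w j] through increments of the entries, which are small; the nonzero factor is then
    divided out. *)
Let kernel_bound j : j != l -> exists K, forall x y (w : 'cV[C]_N),
  cabs (x - x0) <= 1 -> cabs y <= 1 -> Meval x y *m w = 0 ->
  cabs (w j ord0) <= K * (cabs (x - x0) + cabs y) * \sum_i cabs (w i ord0).
Proof.
move=> jl.
have [||K K_gt0 lipM] := @uniform_constant R 'I_N
  (fun i => lipschitz_near (fun x y => (M j i).[x%:P].[y]) x0).
- by move=> i K K'; exact: lipschitz_near_mono.
- by move=> i; have [K _] := bivariate_lipschitz (M j i) x0; exists K.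
pose e := cabs (E j).[x0]; have e_gt0 : 0 < e by rewrite cabs_gt0 E_others.
exists (K / e) => x y w hx hy /matrixP/(_ j ord0); rewrite !mxE => Mw.
set s := cabs _ + cabs y; set T := \sum_i _.
rewrite -(ler_pM2l e_gt0).
have -> : e * (K / e * s * T) = K * s * T by field; rewrite gt_eqF.
rewrite -cabsM.
have -> : (E j).[x0] * w j ord0 =
    - \sum_i (((M j i).[x%:P].[y] - (M j i).[x0%:P].[0]) * w i ord0).
  apply/eqP; rewrite -addr_eq0; apply/eqP.
  rewrite -[RHS]Mw; under eq_bigr do rewrite mulrBl.
  rewrite sumrB addrC -addrA [X in _ + X]addrC.
  have -> : \sum_i (M j i).[x0%:P].[0] * w i ord0 = (E j).[x0] * w j ord0.
    rewrite (bigD1 j) //= horner2 M_diag eqxx mulr1n big1 ?addr0 // => i ij.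
    by rewrite horner2 M_diag eq_sym (negPf ij) mulr0n horner0 mul0r.
  rewrite subrr addr0; apply: eq_bigr => i _; by rewrite !mxE.
rewrite cabsN (le_trans (cabs_sum _ _ _)) // mulr_sumr ler_sum // => i _.
by rewrite cabsM ler_wpM2r ?cabs_ge0 // lipM.
Qed.

(** At the root, every coordinate of a kernel vector other than the [l]-th is [O(|y|)] times the l1
    norm [T]. For small [y] these make up at most half of [T], so the [l]-th coordinate is nonzero
    and can be normalised to 1. *)
Lemma singular_perturbation : exists2 K, 0 < K & forall y, K * cabs y < 1 ->
  exists x (w : 'cV[C]_N), [/\ cabs (x - x0) <= K * cabs y, w l ord0 = 1,
    (forall j, j != l -> cabs (w j ord0) <= K * cabs y) &
    map_mx (fun q => q.[x%:P].[y]) M *m w = 0].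
Proof.
have [K1 K1_gt0 root1] := det_root.
have [K2 K2_gt0 kerb] : exists2 K, 0 < K & forall j, j != l ->
    forall x y (w : 'cV[C]_N),
    cabs (x - x0) <= 1 -> cabs y <= 1 -> Meval x y *m w = 0 ->
    cabs (w j ord0) <= K * (cabs (x - x0) + cabs y) * \sum_i cabs (w i ord0).
  apply: (uniform_constant (P := fun j K => j != l -> forall x y (w : 'cV[C]_N),
    cabs (x - x0) <= 1 -> cabs y <= 1 -> Meval x y *m w = 0 ->
    cabs (w j ord0) <= K * (cabs (x - x0) + cabs y) * \sum_i cabs (w i ord0))).
    move=> j K K' KK' hK jl x y w hx hy Mw.
    apply: le_trans (hK jl x y w hx hy Mw) _.
    rewrite ler_wpM2r ?sumr_ge0 //; first by move=> i _; exact: cabs_ge0.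
    by rewrite ler_wpM2r ?addr_ge0 ?cabs_ge0.
  move=> j; have [->|/kernel_bound[K hK]] := eqVneq j l; first by exists 0.
  by exists K.
have [A A_gt0 AE] : exists2 A, 0 < A & A = K2 * (K1 + 1).
  by exists (K2 * (K1 + 1)); rewrite // mulr_gt0 ?addr_gt0.
have A_ge0 := ltW A_gt0; have K1_ge0 := ltW K1_gt0.
have N1_ge0 : 0 <= N%:R + 1 :> R by rewrite addr_ge0.
(* [K1] controls the root, 1 forces [cabs y <= 1], [2 * A * N] lets the other coordinates be
   absorbed into half of [T], and [2 * A] is the bound after normalisation. *)
pose K := K1 + 1 + 2 * A * (N%:R + 1).
have KK1 : K1 <= K by rewrite /K -addrA lerDl addr_ge0 // !mulr_ge0.
have K_gt0 : 0 < K by exact: lt_le_trans KK1.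
exists K => // y Ky; have y_ge0 := cabs_ge0 y.
have K1y : K1 * cabs y < 1 by apply: le_lt_trans Ky; rewrite ler_wpM2r.
have y1 : cabs y <= 1.
  apply: le_trans (ltW Ky); rewrite ler_peMl //.
  by rewrite /K addrAC lerDr addr_ge0 ?mulr_ge0.
have [x det0 hx] := root1 y K1y.
have hx1 : cabs (x - x0) <= 1 by rewrite (le_trans hx) // ltW.
have [w w_neq0 Mw] : exists2 w : 'cV[C]_N, w != 0 & Meval x y *m w = 0.
  (* [det0P] yields a left kernel vector, hence the transpose. *)
  have /eqP/det0P[v v_neq0 vM] : \det (Meval x y)^T = 0 by rewrite det_tr.
  exists v^T; first by rewrite -trmx0 (inj_eq trmx_inj).
  by apply: trmx_inj; rewrite trmx_mul trmxK vM trmx0.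
pose T := \sum_i cabs (w i ord0).
have T_ge0 : 0 <= T by rewrite sumr_ge0 // => i _; exact: cabs_ge0.
have bound j : j != l -> cabs (w j ord0) <= A * cabs y * T.
  move=> jl; apply: le_trans (kerb j jl x y w hx1 y1 Mw) _.
  rewrite ler_wpM2r // AE -mulrA ler_wpM2l ?(ltW K2_gt0) // mulrDl mul1r.
  by rewrite lerD2r.
have Tle : T <= 2 * cabs (w l ord0).
  have : T <= cabs (w l ord0) + N%:R * (A * cabs y * T).
    rewrite {1}/T (bigD1 l) //= lerD2l.
    apply: le_trans (ler_sum _ bound) _.
    rewrite sumr_const -[leLHS]mulr_natl ler_wpM2r //.
      by rewrite !mulr_ge0.
    by rewrite ler_nat -[leqRHS]card_ord max_card.
  have : 2 * (N%:R * (A * cabs y * T)) <= T.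
    rewrite (_ : 2 * _ = 2 * A * N%:R * cabs y * T); last by ring.
    rewrite ler_piMl //; apply: le_trans (ltW Ky).
    rewrite ler_wpM2r // /K mulrDr mulr1.
    have : 0 <= 2 * A by rewrite mulr_ge0.
    lra.
  lra.
have wl : w l ord0 != 0.
  apply: contraNneq w_neq0 => wl0; apply/eqP/matrixP => i j.
  rewrite ord1 mxE; apply/eqP; rewrite -cabs_eq0 eq_le cabs_ge0 andbT.
  rewrite wl0 cabs0 mulr0 in Tle; apply: le_trans Tle.
  by rewrite /T (bigD1 i) //= lerDl sumr_ge0 // => k _; exact: cabs_ge0.
exists x, ((w l ord0)^-1 *: w); split.
- by apply: le_trans hx _; rewrite ler_wpM2r.
- by rewrite mxE mulVf.
- move=> j jl; rewrite mxE cabsM cabsV ler_pdivrMl ?cabs_gt0 //.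
  apply: le_trans (bound j jl) _.
  apply: (@le_trans _ _ (A * cabs y * (2 * cabs (w l ord0)))).
    by rewrite ler_wpM2l // mulr_ge0 // ltW.
  rewrite mulrCA -mulrA [A * (_ * _)]mulrCA mulrCA.
  have : 0 <= cabs (w l ord0) * cabs y by rewrite mulr_ge0 ?cabs_ge0.
  move=> P0; have : 0 <= (K - 2 * A) * (cabs (w l ord0) * cabs y).
    rewrite mulr_ge0 // /K mulrDr mulr1.
    have : 0 <= 2 * A * N%:R by rewrite !mulr_ge0.
    lra.
  lra.
- by rewrite -scalemxAr Mw scaler0.
Qed.

End SingularPerturbation.

(** * Degenerate perturbation theory *)

Section DegeneratePerturbation.
Variables (R : realType) (N : nat).
Local Notation C := R[i].
Variables (d mu : 'I_N -> C).
Hypothesis mu_inj : forall i j, d i = d j -> mu i = mu j -> i = j.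

(* Degenerate perturbation theory: looking for an eigenvalue
   d_l (1 + y^2 nu), the coordinates outside the eigenspace of d_l are
   rescaled by y; the rescaled equations are diagonal at y = 0. *)
Lemma degenerate_perturbation_diag (V : 'M[C]_N)
  (Vd : forall i j, d i = d j -> V i j = mu i *+ (i == j)) (l : 'I_N) :
  exists2 K, 0 < K & forall y, y != 0 -> K * cabs y < 1 ->
  exists nu (v : 'cV[C]_N), [/\ cabs (nu - mu l) <= K * cabs y, v l ord0 = 1,
    (forall j, j != l -> cabs (v j ord0) <= K * cabs y) &
    diag_mx (\row_i d i) *m (1%:M + y ^+ 2 *: V) *m v =
      (d l * (1 + y ^+ 2 * nu)) *: v].
Proof.
(* The outer ['X] stands for [nu], the constant [Y] for [y], and [r j] is the rescaling of
   coordinate [j]. Multiplying the rows of [M] with [d i = d l] by [d l * y ^+ 2], and the other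
   rows by [y], recovers the eigenvector equation. *)
pose Y : {poly {poly C}} := 'X%:P.
pose cst (c : C) : {poly {poly C}} := c%:P%:P.
pose r j : {poly {poly C}} := if d j == d l then 1 else Y.
pose M : 'M[{poly {poly C}}]_N := \matrix_(i, j)
  if d i == d l then cst (V i j) * r j - 'X *+ (i == j)
  else cst (d i - d l) *+ (i == j) + Y * cst (d i * V i j) * r j
       - Y * Y * cst (d l) * 'X *+ (i == j).
pose E i : {poly C} := if d i == d l then (mu i)%:P - 'X else (d i - d l)%:P.
have Y0 : map_poly (horner_eval 0) Y = 0 :> {poly C}.
  by rewrite map_polyC /= /horner_eval hornerX.
have cst0 c : map_poly (horner_eval 0) (cst c) = c%:P.
  by rewrite map_polyC /= /horner_eval hornerC.
have [||||K K_gt0 pert] := @singular_perturbation R N M E l (mu l).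
- move=> i j; rewrite mxE /E; case: eqP => [dil|_]; last first.
    rewrite rmorphB rmorphD rmorphMn !rmorphMn !rmorphM /= !Y0 cst0.
    by rewrite !mul0r mul0rn addr0 subr0.
  rewrite rmorphB rmorphM rmorphMn /= cst0 map_polyX /r.
  case: eqP => [djl|djl].
    rewrite rmorph1 mulr1 Vd; last by rewrite dil.
    by case: (i == j); rewrite ?mulr1n ?mulr0n ?polyC0 ?subr0.
  rewrite Y0 mulr0; case: eqP => [ij|_]; first by case: djl; rewrite -ij.
  by rewrite !mulr0n subr0.
- by rewrite /E eqxx /root hornerD hornerN hornerC hornerX subrr.
- rewrite /E eqxx derivB derivC derivX sub0r hornerN hornerC oppr_eq0.
  exact: oner_neq0.
- move=> j jl; rewrite /E; have [djl|djl] := eqVneq (d j) (d l).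
    rewrite hornerD hornerN hornerC hornerX subr_eq0.
    by apply: contra_neq jl => /mu_inj; apply.
  by rewrite hornerC subr_eq0.
(* The extra 1 forces [cabs y <= 1], so that undoing the rescaling enlarges no coordinate. *)
exists (K + 1); first by rewrite addr_gt0.
move=> y y0 Ky.
have y_ge0 := cabs_ge0 y; have K_ge0 := ltW K_gt0.
have [y1 Ky'] : cabs y <= 1 /\ K * cabs y < 1.
  have := mulr_ge0 K_ge0 y_ge0; move: Ky; rewrite mulrDl mul1r => ? ?.
  by split; lra.
have Kle : K * cabs y <= (K + 1) * cabs y by rewrite ler_wpM2r // lerDl.
have [nu [w [hnu wl hw Mw]]] := pert y Ky'.
pose ry j := if d j == d l then 1 else y.
exists nu, (\col_j (ry j * w j ord0)); split.
- exact: le_trans Kle.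
- by rewrite mxE /ry eqxx mul1r.
- move=> j jl; rewrite mxE cabsM; apply: le_trans Kle.
  apply: le_trans (hw j jl); rewrite ler_piMl ?cabs_ge0 // /ry.
  by case: ifP; rewrite ?cabs1.
apply/matrixP => i o; rewrite (ord1 o) => {o}; move/matrixP/(_ i ord0): Mw.
rewrite -mulmxA mul_diag_mx mulmxDl mul1mx -scalemxAl !mxE.
pose S := \sum_j V i j * (ry j * w j ord0).
have -> : \sum_j V i j * (\col_j0 (ry j0 * w j0 ord0)) j ord0 = S.
  by apply: eq_bigr => j _; rewrite mxE.
have ryE x j : (r j).[x%:P].[y] = ry j.
  by rewrite /r /ry; case: ifP => _; rewrite hornerC ?hornerX ?hornerC.
have Yev : Y.[nu%:P].[y] = y by rewrite hornerC hornerX.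
have cev c : (cst c).[nu%:P].[y] = c by rewrite hornerC hornerC.
have sumD (F : 'I_N -> C) c :
    \sum_j (F j + c *+ (i == j)) * w j ord0 =
    \sum_j F j * w j ord0 + c * w i ord0.
  under eq_bigr do rewrite mulrDl.
  rewrite big_split /=; congr (_ + _).
  rewrite (bigD1 i) //= eqxx big1 ?addr0 ?mulr1n // => j ji.
  by rewrite eq_sym (negPf ji) mulr0n mul0r.
have [dil|dil] := eqVneq (d i) (d l).
  rewrite (eq_bigr (fun j => (V i j * ry j + (- nu) *+ (i == j)) * w j ord0)).
    rewrite sumD => Mw.
    have -> : S = nu * w i ord0.
      rewrite -[RHS]add0r -Mw; rewrite mulNr subrK.
      by apply: eq_bigr => j _; rewrite mulrA.
    by rewrite /ry dil eqxx; ring.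
  move=> j _; rewrite mxE [M i j]mxE dil eqxx !hornerE ryE.
  by case: (i == j); rewrite ?mulr1n ?mulr0n !hornerE ?subr0.
rewrite (eq_bigr (fun j => (y * d i * (V i j * ry j) +
    (d i - d l - y ^+ 2 * d l * nu) *+ (i == j)) * w j ord0)).
  rewrite sumD => Mw.
  have {}Mw : (d i - d l - y ^+ 2 * d l * nu) * w i ord0 = - (y * d i * S).
    apply/eqP; rewrite -addr_eq0 addrC; apply/eqP; rewrite -[RHS]Mw.
    congr (_ + _); rewrite mulr_sumr; apply: eq_bigr => j _; ring.
  rewrite /ry (negPf dil); apply/eqP; rewrite -subr_eq0.
  apply/eqP; transitivity (y * ((d i - d l - y ^+ 2 * d l * nu) * w i ord0 +
     y * d i * S)); first by ring.
  by rewrite Mw addNr mulr0.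
move=> j _; rewrite mxE [M i j]mxE (negPf dil).
rewrite !(hornerD, hornerN, hornerMn, hornerM) ryE !Yev !cev hornerX hornerC.
by case: (i == j); rewrite ?mulr1n ?mulr0n; ring.
Qed.

(** The unitary matrix [U] with columns [f l] commutes with the diagonal matrix, because [f l] lives
    on the coordinates where the diagonal entry is [d l]; conjugation by [U] therefore reduces to
    the diagonal case. *)
Lemma degenerate_perturbation (W : 'M[C]_N) (f : 'I_N -> 'cV[C]_N) :
  orthonormalC f ->
  (forall l j, f l j ord0 != 0 -> d j = d l) ->
  (forall l j, d j = d l -> (W *m f l) j ord0 = mu l * f l j ord0) ->
  forall l : 'I_N, exists2 K, 0 < K & forall y, y != 0 -> K * cabs y < 1 ->
  exists nu (u : 'cV[C]_N), [/\ cabs (nu - mu l) <= K * cabs y, u != 0,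
    (forall j, cabs (u j ord0 - f l j ord0) <= K * cabs y) &
    diag_mx (\row_i d i) *m (1%:M + y ^+ 2 *: W) *m u =
      (d l * (1 + y ^+ 2 * nu)) *: u].
Proof.
move=> f_on f_supp f_eig l.
pose U : 'M[C]_N := \matrix_(j, m) f m j ord0.
pose Us : 'M[C]_N := \matrix_(m, j) conjc (f m j ord0).
have UsU : Us *m U = 1%:M.
  apply/matrixP => m k; rewrite !mxE eq_sym -f_on; apply: eq_bigr => j _.
  by rewrite !mxE mulrC.
have UUs : U *m Us = 1%:M := mulmx1C UsU.
pose V := Us *m (W *m U).
have WU m j : (W *m U) j m = (W *m f m) j ord0.
  by rewrite !mxE; apply: eq_bigr => i _; rewrite mxE.
(* Only coordinates where [f i] is nonzero contribute, and there the eigenvector relation of [f j]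
   holds; orthonormality does the rest. *)
have Vd i j : d i = d j -> V i j = mu j *+ (i == j).
  move=> dij; rewrite eq_sym -[RHS]mulr_natr -f_on mulr_sumr mxE.
  apply: eq_bigr => m _; rewrite WU mxE.
  have [f0|/f_supp dm] := eqVneq (f i m ord0) 0.
    by rewrite f0 conjc0 mul0r !mulr0.
  by rewrite f_eig ?dm // mulrCA [X in mu j * X]mulrC.
have Vd' i j : d i = d j -> V i j = mu i *+ (i == j).
  by move=> /Vd->; case: eqP => // ->.
have DU : diag_mx (\row_i d i) *m U = U *m diag_mx (\row_i d i).
  rewrite mul_diag_mx mul_mx_diag; apply/matrixP => i j; rewrite !mxE.
  have [->|/f_supp ->] := eqVneq (f j i ord0) 0; last exact: mulrC.
  by rewrite mul0r mulr0.
have [K K_gt0 pert] := degenerate_perturbation_diag Vd' l.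
(* Dominates all absolute row sums of [U], so coordinatewise bounds pass from [v] to [U *m v]. *)
pose B : R := 1 + \sum_j \sum_m cabs (U j m).
have sum_ge0 j : 0 <= \sum_m cabs (U j m).
  by rewrite sumr_ge0 // => m _; exact: cabs_ge0.
have B1 : 1 <= B by rewrite lerDl sumr_ge0.
have UB j : \sum_m cabs (U j m) <= B.
  by rewrite /B [X in 1 + X](bigD1 j) //= addrCA lerDl addr_ge0 // sumr_ge0.
have KB : K <= K * B by rewrite ler_peMr // ltW.
exists (K * B); first exact: lt_le_trans KB.
move=> y y0 Ky; have y_ge0 := cabs_ge0 y.
have [nu [v [hnu vl hv eqv]]] := pert y y0 (le_lt_trans (ler_wpM2r y_ge0 KB) Ky).
exists nu, (U *m v); split.
- by apply: le_trans hnu _; rewrite ler_wpM2r.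
- apply/eqP => /(congr1 (mulmx Us)); rewrite mulmxA UsU mul1mx mulmx0.
  by move=> /matrixP/(_ l ord0); rewrite vl mxE; apply/eqP/oner_neq0.
- move=> j; rewrite mxE (bigD1 l) //= vl mulr1 mxE addrAC subrr add0r.
  apply: le_trans (cabs_sum _ _ _) _.
  apply: (@le_trans _ _ (\sum_(m | m != l) cabs (U j m) * (K * cabs y))).
    by apply: ler_sum => m ml; rewrite cabsM ler_wpM2l ?cabs_ge0 // hv.
  rewrite -mulr_suml mulrAC mulrC ler_wpM2l ?mulr_ge0 ?(ltW K_gt0) //.
  by apply: le_trans (UB j); rewrite [leRHS](bigD1 l) //= lerDr cabs_ge0.
- rewrite scalemxAr -eqv !mulmxA -DU -!mulmxA; congr (_ *m _).
  rewrite mulmxA [RHS]mulmxA; congr (_ *m _).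
  rewrite mulmxDl mulmxDr mul1mx mulmx1 -scalemxAl -scalemxAr; congr (_ + _ *: _).
  by rewrite /V !mulmxA UUs mul1mx.
Qed.

End DegeneratePerturbation.

(** * Fourier modes and their projections *)

Section FourierModes.
Import numFieldNormedType.Exports.
Variable R : realType.
Local Notation C := R[i].
Local Notation mu := (@lebesgue_measure R).
Local Notation I01 := (`[0%R, 1%R] : set R)%classic.
Implicit Types (g h : R -> C) (z : C).

Lemma cexpiD (s t : R) : cexpi (s + t) = cexpi s * cexpi t.
Proof.
rewrite /cexpi cosD sinD; apply/eqP.
by rewrite eq_complex /=; apply/andP; split; apply/eqP; ring.
Qed.

Lemma cabs_cexpi (t : R) : cabs (cexpi t) = 1.
Proof. by rewrite /cabs /= cos2Dsin2 sqrtr1. Qed.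

(** Translation by [alpha j] multiplies the mode by its phase, so the operator acts on mode [k] as a
    matrix. *)
Lemma Ptrans_Ffun (N : nat) (alpha : 'I_N -> R) (W : 'M[R]_N) (k : int)
    (f : 'cV[C]_N) j x :
  Ptrans alpha W (Ffun k f) j x = Ffun k (Dmx k alpha *m mxC W *m f) j x.
Proof.
have E : cexpi (2 * pi * k%:~R * (x - alpha j)) =
    ephase k (alpha j) * cexpi (2 * pi * k%:~R * x).
  by rewrite /ephase -cexpiD; congr cexpi; ring.
rewrite /Ptrans /Ffun -mulmxA mul_diag_mx !mxE E mulr_sumr mulr_suml.
by apply: eq_bigr => i _; rewrite mxE; ring.
Qed.

Definition cint (h : R -> C) : C :=
  Complex (Rintegral mu I01 (fun x => complex.Re (h x)))
          (Rintegral mu I01 (fun x => complex.Im (h x))).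

Definition cintegrable (h : R -> C) : Prop :=
  mu.-integrable I01 (EFin \o (fun x => complex.Re (h x))) /\
  mu.-integrable I01 (EFin \o (fun x => complex.Im (h x))).

Lemma Rintegral01_cst (r : R) : Rintegral mu I01 (fun _ => r) = r.
Proof.
by rewrite Rintegral_cst //= lebesgue_measure_itv /= lte_fin ltr01 oppr0 adde0 mulr1.
Qed.

Lemma integrable01_cst (r : R) : mu.-integrable I01 (EFin \o cst r).
Proof.
apply/integrableP; split; first exact/measurable_EFinP/measurable_cst.
rewrite /= integral_cst //= lebesgue_measure_itv /= lte_fin ltr01.
by rewrite oppr0 adde0 mule1 ltry.
Qed.

Lemma integrable01_lin (u v : R -> R) a b :
  mu.-integrable I01 (EFin \o u) -> mu.-integrable I01 (EFin \o v) ->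
  mu.-integrable I01 (EFin \o (fun x => u x * a + v x * b)).
Proof.
move=> iu iv; rewrite (_ : EFin \o _ = (fun x => (u x)%:E * a%:E + (v x)%:E * b%:E)%E) //.
by apply: integrableD => //; apply: integrableZr.
Qed.

Lemma Rintegral01_lin (u v : R -> R) a b :
  mu.-integrable I01 (EFin \o u) -> mu.-integrable I01 (EFin \o v) ->
  Rintegral mu I01 (fun x => u x * a + v x * b) =
  Rintegral mu I01 u * a + Rintegral mu I01 v * b.
Proof.
move=> iu iv; rewrite RintegralD ?RintegralZr //.
- have := integrable01_lin a 0 iu iu.
  by congr (_.-integrable _ _); apply/funext => x /=; rewrite mulr0 addr0.
- have := integrable01_lin b 0 iv iv.
  by congr (_.-integrable _ _); apply/funext => x /=; rewrite mulr0 addr0.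
Qed.

Lemma cint_mulr h z : cintegrable h -> cint (fun x => h x * z) = cint h * z.
Proof.
case: z => a b [iR iI]; rewrite /cint.
have -> : (fun x => complex.Re (h x * Complex a b)) =
    (fun x => complex.Re (h x) * a + complex.Im (h x) * - b).
  by apply/funext => x; case: (h x) => u v /=; rewrite mulrN.
have -> : (fun x => complex.Im (h x * Complex a b)) =
    (fun x => complex.Re (h x) * b + complex.Im (h x) * a).
  by apply/funext => x; case: (h x) => u v /=.
by rewrite !Rintegral01_lin // mulrN.
Qed.

Lemma measurable_fun_ctrig (m : R) :
  measurable_fun I01 (fun x => cos (m * x)) /\
  measurable_fun I01 (fun x => sin (m * x)).
Proof.
split; apply: measurable_funTS; apply: continuous_measurable_fun => x.
  by apply: (@continuous_comp _ _ _ ( *%R m) cos); [exact: mulrl_continuous | exact: continuous_cos].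
by apply: (@continuous_comp _ _ _ ( *%R m) sin); [exact: mulrl_continuous | exact: continuous_sin].
Qed.

Section SquareIntegrable.
Variables (g : R -> C) (k : int).
Hypothesis mRe : measurable_fun I01 (fun x => complex.Re (g x)).
Hypothesis mIm : measurable_fun I01 (fun x => complex.Im (g x)).
Hypothesis g_fin : (\int[mu]_(x in I01) ((cabs (g x)) ^+ 2)%:E < +oo)%E.

(** With this integrand, [cint h] is the [k]-th Fourier coefficient of [g]. *)
Let h x := g x * conjc (cexpi (2 * pi * k%:~R * x)).

Lemma integrable_cabs2 : mu.-integrable I01 (EFin \o (fun x => cabs (g x) ^+ 2)).
Proof.
apply/integrableP; split.
  apply/measurable_EFinP; rewrite (_ : (fun x => _) =
      (fun x => complex.Re (g x) ^+ 2 + complex.Im (g x) ^+ 2)).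
    by apply: measurable_funD; apply: measurable_funX.
  by apply/funext => x; rewrite cabs_sqr.
apply: le_lt_trans g_fin; rewrite le_eqVlt; apply/orP; left; apply/eqP.
apply: eq_integral => x _ /=.
by rewrite ger0_norm ?exprn_ge0 ?cabs_ge0.
Qed.

(** The mode has modulus 1, so [h] is dominated by [1 + |g|^2], which is integrable on the unit
    interval. *)
Lemma cintegrable_mode : cintegrable h.
Proof.
have dom : mu.-integrable I01 (EFin \o (fun x => cst 1 x * 1 + cabs (g x) ^+ 2 * 1)).
  exact: integrable01_lin (integrable01_cst 1) integrable_cabs2.
have bound x : cabs (h x) <= `|1 * 1 + cabs (g x) ^+ 2 * 1|.
  rewrite /h cabsM cabs_conj cabs_cexpi !mulr1 ger0_norm; last first.
    by rewrite addr_ge0 ?exprn_ge0 ?cabs_ge0.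
  have := sqr_ge0 (cabs (g x) - 1); have := sqr_ge0 (cabs (g x)).
  rewrite sqrrB mulr1 expr1n mulr2n; lra.
have ReIm z : `|complex.Re z| <= cabs z /\ `|complex.Im z| <= cabs z.
  split; rewrite -sqrtr_sqr ler_wsqrtr //; first by rewrite lerDl sqr_ge0.
  by rewrite lerDr sqr_ge0.
have [mc ms] := measurable_fun_ctrig (2 * pi * k%:~R).
split; apply: (le_integrable _ _ _ dom) => //.
- apply/measurable_EFinP; rewrite (_ : (fun x => _) = (fun x =>
    complex.Re (g x) * cos (2 * pi * k%:~R * x) +
    complex.Im (g x) * sin (2 * pi * k%:~R * x))).
    by apply: measurable_funD; apply: measurable_funM.
  by apply/funext => x; rewrite /h /cexpi; case: (g x) => a b /=; ring.
- move=> x _; rewrite /= lee_fin; apply: le_trans (bound x).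
  by have [] := ReIm (h x).
- apply/measurable_EFinP; rewrite (_ : (fun x => _) = (fun x =>
    complex.Im (g x) * cos (2 * pi * k%:~R * x) -
    complex.Re (g x) * sin (2 * pi * k%:~R * x))).
    by apply: measurable_funB; apply: measurable_funM.
  by apply/funext => x; rewrite /h /cexpi; case: (g x) => a b /=; ring.
- move=> x _; rewrite /= lee_fin; apply: le_trans (bound x).
  by have [] := ReIm (h x).
Qed.

(* Integrate |g - c e|^2 >= 0, where e is the mode and c its coefficient. *)
Lemma bessel_mode :
  cabs (cint h) ^+ 2 <= Rintegral mu I01 (fun x => cabs (g x) ^+ 2).
Proof.
have [iR iI] := cintegrable_mode.
pose a := complex.Re (cint h); pose b := complex.Im (cint h).
have iRI := integrable01_lin (- (2 * a)) (- (2 * b)) iR iI.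
have ic := integrable01_cst (a ^+ 2 + b ^+ 2).
have i2 := integrable01_lin 1 1 iRI ic.
(* The expansion of [|h - c|^2], with [c = a + ib], is kept in the shape that [Rintegral01_lin]
   integrates term by term, factors 1 included. *)
have E : Rintegral mu I01 (fun x => cabs (g x) ^+ 2 * 1 +
      ((complex.Re (h x) * - (2 * a) + complex.Im (h x) * - (2 * b)) * 1
       + cst (a ^+ 2 + b ^+ 2) x * 1) * 1) =
    Rintegral mu I01 (fun x => cabs (g x) ^+ 2) * 1
    + ((a * - (2 * a) + b * - (2 * b)) * 1 + (a ^+ 2 + b ^+ 2) * 1) * 1.
  rewrite (Rintegral01_lin 1 1 integrable_cabs2 i2) (Rintegral01_lin 1 1 iRI ic).
  by rewrite (Rintegral01_lin _ _ iR iI) Rintegral01_cst.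
have : 0 <= a * - (2 * a) + b * - (2 * b) + (a ^+ 2 + b ^+ 2)
    + Rintegral mu I01 (fun x => cabs (g x) ^+ 2).
  have -> : a * - (2 * a) + b * - (2 * b) + (a ^+ 2 + b ^+ 2)
    + Rintegral mu I01 (fun x => cabs (g x) ^+ 2) =
    Rintegral mu I01 (fun x => cabs (g x) ^+ 2) * 1
    + ((a * - (2 * a) + b * - (2 * b)) * 1 + (a ^+ 2 + b ^+ 2) * 1) * 1 by ring.
  rewrite -E; apply: Rintegral_ge0 => x _ /=.
  have <- : cabs (h x) ^+ 2 = cabs (g x) ^+ 2.
    by rewrite /h cabsM cabs_conj cabs_cexpi mulr1.
  rewrite cabs_sqr; have := sqr_ge0 (complex.Re (h x) - a).
  have := sqr_ge0 (complex.Im (h x) - b); lra.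
rewrite [cabs (cint h) ^+ 2]cabs_sqr -/a -/b; lra.
Qed.

End SquareIntegrable.

Lemma L2inner_Ffun N (G : 'I_N -> R -> C) (k : int) (f : 'cV[C]_N) :
  (forall j, cintegrable (fun x => G j x * conjc (cexpi (2 * pi * k%:~R * x)))) ->
  L2inner G (Ffun k f) = RtoC (N%:R^-1) *
    cdot (\col_j cint (fun x => G j x * conjc (cexpi (2 * pi * k%:~R * x)))) f.
Proof.
move=> iG; rewrite /L2inner /cdot; congr (_ * _); apply: eq_bigr => j _.
rewrite mxE -cint_mulr //; congr cint; apply/funext => x.
by rewrite /Ffun rmorphM /=; ring.
Qed.

Lemma L2inner_FfunFfun N (k : int) (f : 'cV[C]_N) :
  L2inner (Ffun k f) (Ffun k f) = RtoC (N%:R^-1) * cdot f f.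
Proof.
rewrite /L2inner /cdot; congr (_ * _); apply: eq_bigr => j _.
have E x : Ffun k f j x * conjc (Ffun k f j x) = f j ord0 * conjc (f j ord0).
  by rewrite !mulc_conj /Ffun cabsM cabs_cexpi mulr1.
under eq_Rintegral do rewrite E.
rewrite Rintegral01_cst; under eq_Rintegral do rewrite E.
by rewrite Rintegral01_cst; case: (_ * _).
Qed.

Lemma L2norm_Ffun N (k : int) (f : 'cV[C]_N) :
  L2norm (Ffun k f) = Num.sqrt (N%:R^-1 * \sum_j cabs (f j ord0) ^+ 2).
Proof.
congr (Num.sqrt (_ * _)); apply: eq_bigr => j _.
under eq_Rintegral do rewrite /Ffun cabsM cabs_cexpi mulr1.
exact: Rintegral01_cst.
Qed.

End FourierModes.

(** * Rank-one projections and their convergence in operator norm *)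

Section ModeProjections.
Variables (R : realType) (N : nat).
Local Notation C := R[i].
Implicit Types (c u f : 'cV[C]_N) (k : int).

Lemma cdotE f : cdot f f = RtoC (\sum_j cabs (f j ord0) ^+ 2).
Proof.
rewrite RtoCE rmorph_sum; apply: eq_bigr => j _; exact: mulc_conj.
Qed.

(** The entries [u_i conj(u_j)] and [f_i conj(f_j)] differ by at most [3h], and [cdot u u] differs
    from 1 by at most [3Nh], hence has modulus at least 1/2. Each entry of the difference of
    projections is then at most [2(3h + 3Nh)]. *)
Lemma rank_one_projection_close c u f (h : R) i :
  cdot f f = 1 -> 6 * (N%:R + 1) * h <= 1 -> 0 <= h ->
  (forall j, cabs (u j ord0 - f j ord0) <= h) ->
  cabs (cdot c u / cdot u u * u i ord0 - cdot c f / cdot f f * f i ord0) <=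
    6 * (N%:R + 1) * h * \sum_j cabs (c j ord0).
Proof.
move=> ff1 h_small h0 uf; rewrite ff1 divr1.
have N0 : 0 <= N%:R :> R by [].
have Nh0 : 0 <= N%:R * h by rewrite mulr_ge0.
have f1 j : cabs (f j ord0) <= 1.
  have S1 : \sum_j cabs (f j ord0) ^+ 2 = 1 by have := cdotE f; rewrite ff1 => -[].
  rewrite -(@ler_pXn2r _ 2) ?nnegrE ?cabs_ge0 // expr1n -S1 (bigD1 j) //= lerDl.
  by rewrite sumr_ge0 // => m _; rewrite exprn_ge0 ?cabs_ge0.
have entry a b : cabs (u a ord0 * conjc (u b ord0) - f a ord0 * conjc (f b ord0))
    <= 3 * h.
  rewrite (_ : _ - _ = (u a ord0 - f a ord0) * conjc (u b ord0 - f b ord0) +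
    ((u a ord0 - f a ord0) * conjc (f b ord0) +
     f a ord0 * conjc (u b ord0 - f b ord0))); last by rewrite !rmorphB /=; ring.
  apply: le_trans (cabsD _ _) _; apply: le_trans (lerD (lexx _) (cabsD _ _)) _.
  rewrite !cabsM !cabs_conj.
  have h1 : h <= 1 by nra.
  have := uf a; have := uf b; have := f1 a; have := f1 b.
  have := cabs_ge0 (u a ord0 - f a ord0); have := cabs_ge0 (u b ord0 - f b ord0).
  have := cabs_ge0 (f a ord0); have := cabs_ge0 (f b ord0).
  nra.
have uu_close : cabs (cdot u u - 1) <= 3 * N%:R * h.
  rewrite -ff1 /cdot -sumrB; apply: le_trans (cabs_sum _ _ _) _.
  apply: le_trans (ler_sum _ (fun j _ => entry j j)) _.
  by rewrite sumr_const card_ord -[leLHS]mulr_natl mulrCA mulrA.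
have uu_ge : 1 / 2 <= cabs (cdot u u).
  have := cabsD (cdot u u) (1 - cdot u u).
  rewrite addrC subrK cabs1 cabsB; move: uu_close h_small; lra.
have uu_gt0 : 0 < cabs (cdot u u) by lra.
have uu_neq0 : cdot u u != 0 by rewrite -cabs_gt0.
have -> : cdot c u / cdot u u * u i ord0 - cdot c f * f i ord0 =
  \sum_j c j ord0 * ((u i ord0 * conjc (u j ord0) - f i ord0 * conjc (f j ord0)
     - f i ord0 * conjc (f j ord0) * (cdot u u - 1)) / cdot u u).
  transitivity (\sum_j (c j ord0 * conjc (u j ord0) * (u i ord0 / cdot u u)
      - c j ord0 * conjc (f j ord0) * f i ord0)).
    by rewrite sumrB -!mulr_suml mulrAC -mulrA.
  by apply: eq_bigr => j _; field.
apply: le_trans (cabs_sum _ _ _) _; rewrite mulr_sumr; apply: ler_sum => j _.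
rewrite cabsM mulrC ler_wpM2r ?cabs_ge0 // cabsM cabsV ler_pdivrMr //.
apply: le_trans (cabsD _ _) _; rewrite cabsN !cabsM cabs_conj.
have := entry i j; have := f1 i; have := f1 j.
have := cabs_ge0 (f i ord0); have := cabs_ge0 (f j ord0).
have := cabs_ge0 (cdot u u - 1).
set X := cabs _; set a := cabs (f j _); set b := cabs (f i _); set e := cabs (_ - _).
move=> X0 a0 b0 a1 b1 e3.
have ab1 : b * a * X <= X.
  by rewrite ler_piMl // -[1]mulr1 ler_pM.
have : 6 * (N%:R + 1) * h * (1 / 2) <= 6 * (N%:R + 1) * h * cabs (cdot u u).
  by rewrite ler_wpM2l // !mulr_ge0 // addr_ge0.
move: uu_close; rewrite -/X; lra.
Qed.

(** The weight [1/N] cancels in the quotient, leaving the projection in [C^N] of the vector of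
    [k]-th Fourier coefficients. *)
Lemma proj_span_Ffun (G : 'I_N -> R -> C) k f : (0 < N)%N -> L2fun G ->
  proj_span (Ffun k f) G =
  Ffun k ((cdot (\col_j cint (fun x => G j x *
    conjc (cexpi (2 * pi * k%:~R * x)))) f / cdot f f) *: f).
Proof.
move=> N0 L2G; apply/funext => j; apply/funext => x.
rewrite /proj_span L2inner_FfunFfun L2inner_Ffun; last first.
  by move=> i; have [? ? ?] := L2G i; exact: cintegrable_mode.
rewrite /Ffun mxE mulrA -mulf_div mulfV ?mul1r //.
by rewrite RtoCE fmorph_eq0 invr_eq0 pnatr_eq0 -lt0n.
Qed.

Lemma proj_opnorm_cvg_Ffun k (fe : R -> 'cV[C]_N) f : (0 < N)%N ->
  cdot f f = 1 ->
  (forall h, 0 < h -> exists delta, 0 < delta /\ forall eps, 0 < eps < delta ->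
     forall j, cabs (fe eps j ord0 - f j ord0) <= h) ->
  proj_opnorm_cvg (fun eps => Ffun k (fe eps)) (Ffun k f).
Proof.
move=> N0 ff1 fe_cvg eta eta0.
have N1 : 1 <= N%:R :> R by rewrite ler1n.
pose B : R := 6 * (N%:R + 1).
have B0 : 0 < B by rewrite mulr_gt0 // addr_gt0 // ltr0n.
(* One factor [N] compares the l1 norm of the coefficient vector with its l2 norm, the other covers
   the sum over [N] coordinates. The bound [B^-1] in [h] is the smallness required by
   [rank_one_projection_close]. *)
pose A := B * N%:R ^+ 2.
have A0 : 0 < A by rewrite mulr_gt0 // exprn_gt0 // ltr0n.
pose h := Num.min (eta / A) B^-1.
have h0 : 0 < h by rewrite lt_min divr_gt0 //= invr_gt0.
have hA : A * h <= eta by rewrite mulrC -ler_pdivlMr // ge_min lexx.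
have hB : B * h <= 1 by rewrite mulrC -ler_pdivlMr // div1r ge_min lexx orbT.
have [delta [delta0 close]] := fe_cvg h h0.
exists delta; split=> // eps /close {}close G L2G.
pose c : 'cV[C]_N := \col_j cint (fun x => G j x *
  conjc (cexpi (2 * pi * k%:~R * x))).
rewrite !proj_span_Ffun // -/c.
set u := fe eps; pose v : 'cV[C]_N :=
  (cdot c u / cdot u u) *: u - (cdot c f / cdot f f) *: f.
rewrite (_ : (fun j x => _) = Ffun k v); last first.
  by apply/funext => j; apply/funext => x; rewrite /Ffun !mxE mulrBl.
pose s := \sum_j cabs (c j ord0) ^+ 2.
have s0 : 0 <= s by rewrite sumr_ge0 // => j _; rewrite exprn_ge0 ?cabs_ge0.
have vi i : cabs (v i ord0) ^+ 2 <= (B * h * (N%:R * Num.sqrt s)) ^+ 2.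
  rewrite ler_pXn2r ?nnegrE ?cabs_ge0 //; last first.
    by rewrite !mulr_ge0 ?sqrtr_ge0 // ltW.
  rewrite !mxE; apply: le_trans (rank_one_projection_close c i ff1 hB (ltW h0) close) _.
  rewrite ler_wpM2l ?(mulr_ge0 (ltW B0) (ltW h0)) //.
  apply: (@le_trans _ _ (\sum_(j < N) Num.sqrt s)); last first.
    by rewrite sumr_const card_ord mulr_natl.
  apply: ler_sum => j _; rewrite -[leLHS]ger0_norm ?cabs_ge0 // -sqrtr_sqr.
  rewrite ler_wsqrtr // /s (bigD1 j) //= lerDl sumr_ge0 // => m _.
  by rewrite exprn_ge0 ?cabs_ge0.
have vs : \sum_j cabs (v j ord0) ^+ 2 <= eta ^+ 2 * s.
  apply: le_trans (ler_sum _ (fun i _ => vi i)) _.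
  rewrite sumr_const card_ord -[leLHS]mulr_natl !exprMn sqr_sqrtr // !mulrA.
  rewrite ler_wpM2r //; apply: (@le_trans _ _ ((A * h) ^+ 2)).
    pose t := B ^+ 2 * h ^+ 2 * N%:R ^+ 2.
    have -> : (A * h) ^+ 2 = N%:R ^+ 2 * t by rewrite /A /t; ring.
    rewrite [leLHS](_ : _ = N%:R * t); last by rewrite /t /B; ring.
    rewrite ler_wpM2r // ?mulr_ge0 ?exprn_ge0 ?(ltW B0) ?(ltW h0) //.
    by rewrite expr2 ler_peMl.
  by rewrite ler_pXn2r ?nnegrE // ltW // mulr_gt0.
rewrite L2norm_Ffun /L2norm -[X in _ <= X * _]ger0_norm ?(ltW eta0) //.
rewrite -sqrtr_sqr -sqrtrM ?sqr_ge0 // ler_wsqrtr // mulrCA.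
rewrite ler_wpM2l ?invr_ge0 //; apply: le_trans vs _.
rewrite ler_wpM2l ?sqr_ge0 //; apply: ler_sum => j _.
by rewrite mxE; have [? ? ?] := L2G j; exact: bessel_mode.
Qed.

End ModeProjections.

(** * Eigenbases adapted to the bands *)

Section SymmetricEigenbasis.
Variable R : realType.

Lemma mulmx_trE n (u v : 'rV[R]_n) :
  (u *m v^T) ord0 ord0 = \sum_j u ord0 j * v ord0 j.
Proof. by rewrite mxE; apply: eq_bigr => j _; rewrite mxE. Qed.

(** By symmetry, eigenvectors for distinct eigenvalues are orthogonal, so it suffices to normalise
    one per eigenvalue. They are rows because [eigenvalue] refers to multiplication on the left. *)
Lemma symmetric_eigenbasis n (A : 'M[R]_n) :
  A^T = A -> n_distinct_eigenvalues A ->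
  exists (e : 'I_n -> R) (u : 'I_n -> 'rV[R]_n),
    [/\ injective e, forall i, u i *m A = e i *: u i &
        forall i j, u i *m (u j)^T = (i == j)%:R%:M].
Proof.
move=> A_sym [e [e_inj e_eig]].
have /choice[v v_eig] : forall i, exists v : 'rV[R]_n, v *m A = e i *: v /\ v != 0.
  by move=> i; have /eigenvalueP[v] := e_eig i; exists v.
have orth i j : i != j -> v i *m (v j)^T = 0.
  move=> ij; have : (e i - e j) *: (v i *m (v j)^T) = 0.
    rewrite scalerBl scalemxAl; have [<- _] := v_eig i.
    rewrite scalemxAr -linearZ /=; have [<- _] := v_eig j.
    by rewrite trmx_mul A_sym mulmxA subrr.
  move/eqP; rewrite scaler_eq0 subr_eq0 (inj_eq e_inj) (negPf ij) /=.
  by move/eqP.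
pose q i := (v i *m (v i)^T) ord0 ord0.
have q_gt0 i : 0 < q i.
  rewrite /q mulmx_trE lt_def sumr_ge0 ?andbT => [|j _]; last exact: sqr_ge0.
  have [_] := v_eig i; apply: contra_neq => q0.
  apply/rowP => j; rewrite mxE; apply/eqP; rewrite -sqrf_eq0 expr2.
  by apply/eqP; apply: (psumr_eq0P _ q0) => // m _; rewrite -expr2 sqr_ge0.
exists e, (fun i => (Num.sqrt (q i))^-1 *: v i); split => // [i|i j].
  by rewrite -scalemxAl; have [-> _] := v_eig i; rewrite !scalerA mulrC.
rewrite -scalemxAl linearZ /= -scalemxAr scalerA.
have [<-|/orth->] := eqVneq i j; last first.
  by rewrite scaler0 raddf0.
rewrite [v i *m _]mx11_scalar -/(q i) scale_scalar_mx -invfM -expr2.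
by rewrite sqr_sqrtr ?ltW // mulVf // gt_eqF.
Qed.

End SymmetricEigenbasis.

(** * Band combinatorics and the eigenbasis of the block-diagonal matrix *)

Section Bands.
Variables (R : realType) (S N : nat) (L : 'I_S -> nat) (Wd : 'M[R]_N).
Hypothesis L_band : bandwidth_vector L N.
Hypothesis Wd_sym : Wd^T = Wd.
Hypothesis Wd_eig : forall s, n_distinct_eigenvalues (blockmx L Wd s).

(** Start of band [n], defined for every natural [n] so that the end of the last band is covered
    too. *)
Let cum n := (\sum_(t < S | (t < n)%N) L t)%N.

Let cumS (s : 'I_S) : cum s.+1 = (bandstart L s + L s)%N.
Proof.
rewrite /cum (bigD1 s) //= addnC; congr (_ + _)%N; apply: eq_bigl => t.
by rewrite ltnS ltn_neqAle andbC.
Qed.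

Let leq_cum m n : (m <= n)%N -> (cum m <= cum n)%N.
Proof.
move=> mn; rewrite /cum [leqRHS](bigID (fun t : 'I_S => (t < m)%N)) /=.
rewrite (eq_bigl (fun t : 'I_S => (t < n)%N && (t < m)%N)) ?leq_addr // => t.
by case: ltnP => [tm|]; rewrite ?andbF // (leq_trans tm mn).
Qed.

Let cum_max : cum S = N.
Proof.
have [_ <-] := L_band; apply: eq_bigl => t; exact: ltn_ord.
Qed.

Lemma inB_exists (j : 'I_N) : exists s, inB L s j.
Proof.
suff H n : (n <= S)%N -> (j < cum n)%N -> exists s, inB L s j.
  by apply: (H S); rewrite ?cum_max.
elim: n => [|n IHn] nS; first by rewrite /cum big_pred0.
have [jn _|nj] := ltnP j (cum n); first exact: IHn (ltnW nS) jn.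
by rewrite (cumS (Ordinal nS)) => jn; exists (Ordinal nS); rewrite /inB nj.
Qed.

Lemma inB_inj s t (j : 'I_N) : inB L s j -> inB L t j -> s = t.
Proof.
move=> /andP[sj js] /andP[tj jt]; apply: val_inj => /=.
wlog lt_st : s t sj js tj jt / (s < t)%N.
  move=> H; have [lt_st|lt_ts|//] := ltngtP s t; first exact: H lt_st.
  by apply/esym; exact: H lt_ts.
have := leq_trans js (leq_trans _ tj).
by rewrite -cumS => /(_ (leq_cum lt_st)); rewrite ltnn.
Qed.

Lemma inB_hatW s (i j : 'I_N) : inB L s i ->
  hatW L Wd i j = if inB L s j then Wd i j else 0.
Proof.
move=> si; rewrite mxE; case: ifP => [/existsP[t /andP[ti tj]]|].
  by rewrite -(inB_inj ti si) tj.
by case: ifP => // sj /existsP[]; exists s; rewrite si.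
Qed.

Lemma hatW_sym : (hatW L Wd)^T = hatW L Wd.
Proof.
apply/matrixP => i j; rewrite !mxE -[in LHS]Wd_sym mxE.
by congr (if _ then _ else _); apply: eq_existsb => s; rewrite andbC.
Qed.

Let band_bound s (a : 'I_(L s)) : (bandstart L s + a < N)%N.
Proof.
apply: (@leq_trans (cum s.+1)); first by rewrite cumS ltn_add2l.
by rewrite -cum_max leq_cum.
Qed.

(** [P] includes the coordinates of band [s]. As [P *m P^T] is the identity and [P] intertwines
    [hatW] with its block, multiplying an eigenbasis of the block by [P] gives the required vectors.
    The pair [eu] lets a single choice over [s] extract both families. *)
Lemma block_eigenbasis s : exists eu : ('I_N -> R) * ('I_N -> 'rV[R]_N),
  [/\ forall l m, inB L s l -> inB L s m -> eu.1 l = eu.1 m -> l = m,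
      forall l, inB L s l -> eu.2 l *m hatW L Wd = eu.1 l *: eu.2 l,
      forall l j, inB L s l -> eu.2 l ord0 j != 0 -> inB L s j &
      forall l m, inB L s l -> inB L s m ->
        eu.2 l *m (eu.2 m)^T = (l == m)%:R%:M].
Proof.
pose iota (a : 'I_(L s)) := Ordinal (band_bound a).
have iota_inj : injective iota.
  by move=> a b /(congr1 val) /= /addnI/val_inj.
have iota_in a : inB L s (iota a) by rewrite /inB /= leq_addr ltn_add2l ltn_ord.
have L_gt0 : (0 < L s)%N by case: L_band.
(* Inverse of [iota] on the band; its values elsewhere are arbitrary, each conclusion being
   restricted to the band. *)
pose pos (l : 'I_N) : 'I_(L s) := insubd (Ordinal L_gt0) (l - bandstart L s)%N.
have posK l : inB L s l -> iota (pos l) = l.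
  move=> /andP[sl ls]; apply: val_inj => /=; rewrite val_insubd.
  by rewrite ltn_subLR // ls subnKC.
pose P : 'M[R]_(L s, N) := \matrix_(a, j) (j == iota a)%:R.
have PE n (a : 'I_(L s)) (F : 'M[R]_(N, n)) j : (P *m F) a j = F (iota a) j.
  rewrite mxE (bigD1 (iota a)) //= mxE eqxx mul1r big1 ?addr0 // => i ia.
  by rewrite mxE (negPf ia) mul0r.
have PP : P *m P^T = 1%:M.
  by apply/matrixP => a b; rewrite PE !mxE (inj_eq iota_inj).
have PW : P *m hatW L Wd = blockmx L Wd s *m P.
  apply/matrixP => a j; rewrite PE (inB_hatW _ (iota_in a)) mxE.
  have blockE b : blockmx L Wd s a b = Wd (iota a) (iota b).
    rewrite mxE (eq_bigl (xpred1 (iota a))) // big_pred1_eq.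
    by rewrite (eq_bigl (xpred1 (iota b))) // big_pred1_eq.
  case: ifP => [sj|/negP sj].
    rewrite (bigD1 (pos j)) //= blockE [P _ _]mxE posK // eqxx mulr1 big1 ?addr0 // => b bj.
    rewrite [P _ _]mxE; have [jb|_] := eqVneq j (iota b); last by rewrite mulr0.
    by case/eqP: bj; apply: iota_inj; rewrite posK.
  rewrite big1 // => b _; rewrite [P _ _]mxE.
  have [jb|_] := eqVneq j (iota b); last by rewrite mulr0.
  by case: sj; rewrite jb.
have block_sym : (blockmx L Wd s)^T = blockmx L Wd s.
  apply/matrixP => a b; rewrite !mxE exchange_big /=.
  by apply: eq_bigr => i _; apply: eq_bigr => j _; rewrite -[in LHS]Wd_sym mxE.
have [e [u [e_inj u_eig u_on]]] := symmetric_eigenbasis block_sym (Wd_eig s).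
exists (fun l => e (pos l), fun l => u (pos l) *m P); split => /=.
- by move=> l m sl sm /e_inj pos_lm; rewrite -(posK l sl) pos_lm posK.
- by move=> l sl; rewrite -mulmxA PW mulmxA u_eig scalemxAl.
- move=> l j sl; apply: contraNT => sj; rewrite mxE big1 // => a _.
  rewrite [P _ _]mxE; have [ja|_] := eqVneq j (iota a); last by rewrite mulr0.
  by case/negP: sj; rewrite ja.
- move=> l m sl sm; rewrite trmx_mul mulmxA -[_ *m P *m _]mulmxA PP mulmx1 u_on.
  congr ((nat_of_bool _)%:R%:M); apply/idP/idP => [/eqP pos_lm|/eqP-> //].
  by rewrite -(posK l sl) pos_lm posK.
Qed.

(** Each index takes the vector given to it by its own band; vectors of different bands are
    orthogonal because their supports are disjoint. *)
Lemma banded_eigenbasis : exists (e : 'I_N -> R) (u : 'I_N -> 'rV[R]_N),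
  [/\ forall s l m, inB L s l -> inB L s m -> e l = e m -> l = m,
      forall l, u l *m hatW L Wd = e l *: u l,
      forall s l j, inB L s l -> u l ord0 j != 0 -> inB L s j &
      forall l m, u l *m (u m)^T = (l == m)%:R%:M].
Proof.
have /choice[band bandP] := inB_exists.
have /choice[eu euP] := block_eigenbasis.
exists (fun l => (eu (band l)).1 l), (fun l => (eu (band l)).2 l); split.
- move=> s l m sl sm; have [inj _ _ _] := euP s.
  by rewrite (inB_inj (bandP l) sl) (inB_inj (bandP m) sm); exact: inj.
- by move=> l; have [_ eig _ _] := euP (band l); exact: eig.
- move=> s l j sl; rewrite (inB_inj (bandP l) sl).
  by have [_ _ supp _] := euP s; exact: supp.
move=> l m; have [_ _ supp_l on_l] := euP (band l).
have [_ _ supp_m _] := euP (band m).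
have [lm|lm] := eqVneq (band l) (band m).
  by rewrite -lm on_l // lm.
have -> : (l == m) = false by apply: contraNF lm => /eqP->.
apply/matrixP => i j; rewrite !ord1 mulmx_trE mxE mul0rn big1 // => k _.
have [->|/(supp_l _ _ (bandP l)) lk] := eqVneq ((eu (band l)).2 l ord0 k) 0.
  by rewrite mul0r.
have [->|/(supp_m _ _ (bandP m)) mk] := eqVneq ((eu (band m)).2 m ord0 k) 0.
  by rewrite mulr0.
by case/eqP: lm; exact: inB_inj lk mk.
Qed.

End Bands.

(** * Perturbed eigenvectors of the transfer operator *)

Section Assembly.
Variables (R : realType) (N : nat) (alpha : 'I_N -> R) (k : int) (Wd : 'M[R]_N).
Variables (e : 'I_N -> R) (u : 'I_N -> 'rV[R]_N).
Local Notation C := R[i].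
Let d (l : 'I_N) : C := ephase k (alpha l).
Let mu (l : 'I_N) : C := RtoC (e l).
Let f (l : 'I_N) : 'cV[C]_N := mxC (u l)^T.

Hypothesis u_orthonormal : forall l m, u l *m (u m)^T = (l == m)%:R%:M.
Hypothesis u_support : forall l j, u l ord0 j != 0 -> d j = d l.
Hypothesis u_eigen : forall l j, d j = d l ->
  (u l *m Wd) ord0 j = e l * u l ord0 j.
Hypothesis e_inj : forall l m, d l = d m -> e l = e m -> l = m.
Hypothesis Wd_sym : Wd^T = Wd.

Let cabs_d l : cabs (d l) = 1.
Proof. exact: cabs_cexpi. Qed.

Let mu_inj l m : d l = d m -> mu l = mu m -> l = m.
Proof. by move=> dlm [] /e_inj; apply. Qed.

Lemma eigenbasis_orthonormal : orthonormalC f.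
Proof.
move=> l m; have /matrixP/(_ ord0 ord0) := u_orthonormal l m.
rewrite mulmx_trE mxE eqxx mulr1n => /(congr1 (@RtoC R)).
rewrite RtoCE rmorph_nat => <-; rewrite rmorph_sum; apply: eq_bigr => j _.
rewrite rmorphM !mxE /=; congr (_ * _); apply/eqP.
by rewrite eq_complex /= oppr0 !eqxx.
Qed.

Let f_support l j : f l j ord0 != 0 -> d j = d l.
Proof.
move=> flj; apply: u_support; apply: contra_neq flj => ulj.
by rewrite !mxE ulj.
Qed.

Let f_eigen l j : d j = d l -> (mxC Wd *m f l) j ord0 = mu l * f l j ord0.
Proof.
move=> /u_eigen/(congr1 (@RtoC R)); rewrite mxE RtoCE rmorph_sum rmorphM => ulj.
rewrite mxE [f l j ord0]mxE [(u l)^T _ _]mxE -[RHS]ulj; apply: eq_bigr => i _.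
by rewrite rmorphM mulrC !mxE -[in RHS]Wd_sym mxE.
Qed.

(** If the phases agree, equal eigenvalues force [nu = nu'], impossible once [2 * K * y] is below
    the gap between the [mu]. If they differ, the gap between phases beats a correction of order
    [y ^+ 2]. *)
Let distinct_gap K (p : 'I_N * 'I_N) : exists G, p.1 != p.2 ->
  forall y : R, 0 < y -> G * y < 1 -> K * y < 1 -> forall nu nu' : C,
  cabs (nu - mu p.1) <= K * y -> cabs (nu' - mu p.2) <= K * y ->
  d p.1 * (1 + RtoC y ^+ 2 * nu) <> d p.2 * (1 + RtoC y ^+ 2 * nu').
Proof.
case: p => l m /=.
have [->|lm] := eqVneq l m; first by exists 0.
have [dlm|dlm] := eqVneq (d l) (d m).
  pose g := cabs (mu l - mu m).
  have g_gt0 : 0 < g.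
    by rewrite cabs_gt0 subr_eq0; apply: contra_neq lm; exact: mu_inj.
  exists (2 * K / g) => _ y y0 Gy _ nu nu' hnu hnu' /eqP.
  rewrite dlm (inj_eq (mulfI _)) -?cabs_gt0 ?cabs_d //.
  rewrite (inj_eq (addrI _)) (inj_eq (mulfI _)); last first.
    by rewrite expf_neq0 // -cabs_gt0 cabs_RtoC normr_gt0 gt_eqF.
  move=> /eqP nuE; subst nu'.
  have : g <= 2 * K * y.
    have := cabsD (mu l - nu) (nu - mu m); rewrite addrA subrK -/g.
    rewrite cabsB; move: hnu hnu'; lra.
  by move: Gy; rewrite mulrAC ltr_pdivrMr // mul1r ltNge => /negP.
pose g := cabs (d l - d m).
have g_gt0 : 0 < g by rewrite cabs_gt0 subr_eq0.
(* Bounds [|nu| + |nu'|], each lying within [K * y < 1] of its limit. *)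
pose B := cabs (mu l) + cabs (mu m) + 2.
have B_ge0 : 0 <= B by rewrite !addr_ge0 ?cabs_ge0.
exists (1 + B / g) => _ y y0 Gy Ky nu nu' hnu hnu' E.
have y1 : y < 1.
  apply: le_lt_trans Gy; rewrite ler_peMl ?(ltW y0) // lerDl.
  by rewrite divr_ge0 // ltW.
have bound z z' : cabs (z - z') <= K * y -> cabs z <= cabs z' + 1.
  by have := cabsD (z - z') z'; rewrite subrK; move: Ky; lra.
have : g <= y ^+ 2 * B.
  rewrite /g (_ : d l - d m = RtoC y ^+ 2 * (d m * nu' - d l * nu)); last first.
    apply/eqP; rewrite -subr_eq0; apply/eqP.
    transitivity (d l * (1 + RtoC y ^+ 2 * nu) - d m * (1 + RtoC y ^+ 2 * nu')).
      by ring.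
    by rewrite E subrr.
  rewrite expr2 !cabsM cabs_RtoC ger0_norm ?(ltW y0) // -expr2.
  rewrite ler_wpM2l ?sqr_ge0 //; apply: le_trans (cabsD _ _) _.
  rewrite cabsN !cabsM !cabs_d !mul1r.
  by have := bound _ _ hnu; have := bound _ _ hnu'; rewrite /B; lra.
have : B * y < g.
  move: Gy; rewrite mulrDl mul1r => Gy.
  have : B / g * y < 1 by move: y0 Gy; lra.
  by rewrite mulrAC ltr_pdivrMr // mul1r.
have : y ^+ 2 * B <= B * y.
  by rewrite mulrC ler_wpM2l // expr2 ler_piMl // ltW.
lra.
Qed.

(** Degenerate perturbation is used at [y = sqrt eps], with one constant [K] for all indices and one
    constant [G] separating all pairs of eigenvalues. *)
Lemma perturbed_eigenvectors : (0 < N)%N ->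
  exists eps0 : R, 0 < eps0 /\
  exists (lam : R -> 'I_N -> C) (fe : R -> 'I_N -> 'cV[C]_N),
    (forall eps : R, 0 < eps < eps0 ->
       injective (lam eps) /\
       forall l : 'I_N,
         [/\ fe eps l != 0,
             Dmx k alpha *m mxC (Weps Wd eps) *m fe eps l
               = lam eps l *: fe eps l &
             forall (j : 'I_N) (x : R),
               Ptrans alpha (Weps Wd eps) (Ffun k (fe eps l)) j x
                 = lam eps l * Ffun k (fe eps l) j x]) /\
    (forall l : 'I_N, cvg0plus (fun eps => lam eps l) (ephase k (alpha l))) /\
    (forall l : 'I_N,
       proj_opnorm_cvg (fun eps => Ffun k (fe eps l)) (Ffun k (f l))).
Proof.
move=> N_gt0.
pose P l K := forall y : C, y != 0 -> K * cabs y < 1 ->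
  exists nu (v : 'cV[C]_N), [/\ cabs (nu - mu l) <= K * cabs y, v != 0,
    (forall j, cabs (v j ord0 - f l j ord0) <= K * cabs y) &
    diag_mx (\row_i d i) *m (1%:M + y ^+ 2 *: mxC Wd) *m v =
      (d l * (1 + y ^+ 2 * nu)) *: v].
have [l K K' KK' PK y y0 K'y|l|K K_gt0 pert] := @uniform_constant R 'I_N P.
- have KK'y : K * cabs y <= K' * cabs y by rewrite ler_wpM2r ?cabs_ge0.
  have [nu [v [h1 h2 h3 h4]]] := PK y y0 (le_lt_trans KK'y K'y).
  exists nu, v; split=> //; first exact: le_trans KK'y.
  by move=> j; exact: le_trans KK'y.
- have [K _ PK] := degenerate_perturbation mu_inj eigenbasis_orthonormal
    f_support f_eigen l.
  by exists K.
have [||G G_gt0 gap] := @uniform_constant R _ (fun p G => p.1 != p.2 ->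
  forall y : R, 0 < y -> G * y < 1 -> K * y < 1 -> forall nu nu' : C,
  cabs (nu - mu p.1) <= K * y -> cabs (nu' - mu p.2) <= K * y ->
  d p.1 * (1 + RtoC y ^+ 2 * nu) <> d p.2 * (1 + RtoC y ^+ 2 * nu')) .
- move=> p G G' GG' PG p12 y y0 G'y; apply: PG => //.
  by apply: le_lt_trans G'y; rewrite ler_wpM2r // ltW.
- exact: distinct_gap.
(* Below [eps0] one has [(K + G) * Num.sqrt eps < 1], which gives both smallness conditions. *)
pose eps0 := (K + G)^-1 ^+ 2.
have KG_gt0 : 0 < K + G by rewrite addr_gt0.
have eps0_gt0 : 0 < eps0 by rewrite exprn_gt0 // invr_gt0.
have small eps : 0 < eps < eps0 ->
    [/\ 0 < Num.sqrt eps, K * Num.sqrt eps < 1 & G * Num.sqrt eps < 1].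
  move=> /andP[eps_gt0 eps_lt]; have s_gt0 : 0 < Num.sqrt eps by rewrite sqrtr_gt0.
  have : (K + G) * Num.sqrt eps < 1.
    rewrite mulrC -ltr_pdivlMr // div1r -(@ltr_pXn2r _ 2) ?nnegrE ?invr_ge0 ?ltW //.
    by rewrite sqr_sqrtr // ltW.
  rewrite mulrDl; have := mulr_gt0 K_gt0 s_gt0; have := mulr_gt0 G_gt0 s_gt0.
  by split => //; lra.
(* Choice requires a total function; [(0, 0)] is a placeholder outside the range of [eps]. *)
have /choice[F FP] : forall p : R * 'I_N, exists q : C * 'cV[C]_N,
    0 < p.1 < eps0 -> [/\ cabs (q.1 - mu p.2) <= K * Num.sqrt p.1, q.2 != 0,
    (forall j, cabs (q.2 j ord0 - f p.2 j ord0) <= K * Num.sqrt p.1) &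
    Dmx k alpha *m mxC (Weps Wd p.1) *m q.2 =
      (d p.2 * (1 + RtoC p.1 * q.1)) *: q.2].
  move=> [eps l] /=; have [heps|] := boolP (0 < eps < eps0); last by exists (0, 0).
  have [s_gt0 Ks _] := small eps heps.
  have s_abs : cabs (RtoC (Num.sqrt eps)) = Num.sqrt eps.
    by rewrite cabs_RtoC ger0_norm // ltW.
  have s_neq0 : RtoC (Num.sqrt eps) != 0 by rewrite -cabs_gt0 s_abs.
  have s2 : RtoC (Num.sqrt eps) ^+ 2 = RtoC eps.
    by rewrite RtoCE -rmorphXn sqr_sqrtr //; case/andP: heps => /ltW.
  have := pert l _ s_neq0; rewrite s_abs s2 => /(_ Ks)[nu [v [h1 h2 h3 h4]]].
  exists (nu, v) => _; split => //=; rewrite -h4; congr (_ *m _ *m _).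
  by rewrite /mxC /Weps RtoCE map_mxD map_mx1 map_mxZ.
pose lam eps l := d l * (1 + RtoC eps * (F (eps, l)).1).
pose fe eps l := (F (eps, l)).2.
exists eps0; split=> //; exists lam, fe; split; [|split].
- move=> eps heps; have [s_gt0 Ks Gs] := small eps heps; split.
    move=> l m; apply: contra_eq => lm; apply/eqP.
    have [h1 _ _ _] := FP (eps, l) heps; have [h2 _ _ _] := FP (eps, m) heps.
    have := gap (l, m) lm _ s_gt0 Gs Ks _ _ h1 h2.
    by rewrite RtoCE -rmorphXn sqr_sqrtr //; case/andP: heps => /ltW.
  move=> l; have [_ h2 _ h4] := FP (eps, l) heps; split => // j x.
  by rewrite Ptrans_Ffun h4 /Ffun mxE mulrA.
- move=> l eta eta_gt0; pose B := cabs (mu l) + 1.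
  have B_gt0 : 0 < B by rewrite ltr_wpDl ?cabs_ge0.
  exists (Num.min eps0 (eta / B)); split; first by rewrite lt_min eps0_gt0 divr_gt0.
  move=> eps /andP[eps_gt0]; rewrite lt_min => /andP[eps_lt].
  rewrite ltr_pdivlMr // => epsB.
  have heps : 0 < eps < eps0 by rewrite eps_gt0.
  have [_ Ks _] := small eps heps; have [h1 _ _ _] := FP (eps, l) heps.
  apply: le_lt_trans epsB; rewrite /lam mulrDr mulr1 addrAC subrr add0r.
  rewrite !cabsM cabs_d mul1r cabs_RtoC gtr0_norm // ler_wpM2l ?(ltW eps_gt0) //.
  have := cabsD ((F (eps, l)).1 - mu l) (mu l); rewrite subrK.
  by move: h1 Ks; rewrite /B /=; lra.
move=> l; apply: proj_opnorm_cvg_Ffun => //.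
  by rewrite eigenbasis_orthonormal eqxx.
move=> h h_gt0; exists (Num.min eps0 ((h / K) ^+ 2)).
split; first by rewrite lt_min eps0_gt0 exprn_gt0 // divr_gt0.
move=> eps /andP[eps_gt0]; rewrite lt_min => /andP[eps_lt epsh] j.
have heps : 0 < eps < eps0 by rewrite eps_gt0.
have [_ _ h3 _] := FP (eps, l) heps; apply: le_trans (h3 j) _ => /=.
rewrite mulrC -ler_pdivlMr // -(@ler_pXn2r _ 2) ?nnegrE ?sqrtr_ge0 //; last first.
  by rewrite divr_ge0 // ltW.
by rewrite sqr_sqrtr ltW.
Qed.

End Assembly.

(** * Complexified real eigenvectors and the conclusion *)

Section RealEigenvectors.
Variable R : realType.

Lemma mxC_eigen n (A : 'M[R]_n) (u : 'rV[R]_n) (e : R) :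
  A^T = A -> u *m A = e *: u ->
  mxC A *m mxC u^T = RtoC e *: mxC u^T.
Proof.
move=> A_sym uA; rewrite /mxC RtoCE -map_mxM -[in LHS]A_sym -trmx_mul uA.
by rewrite linearZ map_mxZ.
Qed.

Lemma orthonormalC_neq0 n (f : 'I_n -> 'cV[R[i]]_n) l :
  orthonormalC f -> f l != 0.
Proof.
move=> f_on; apply/eqP => fl0; have := f_on l l.
rewrite fl0 eqxx /cdot big1 => [/esym/eqP|j _]; first by rewrite oner_eq0.
by rewrite mxE mul0r.
Qed.

End RealEigenvectors.

Theorem theorem2p5 (R : realType) (N S : nat) (L : 'I_S -> nat)
  (Wd : 'M[R]_N) (beta : 'I_S -> R) (alpha : 'I_N -> R) (k : int) :
  (1 <= N)%N -> (1 <= S <= N)%N ->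
  bandwidth_vector L N ->
  admissible L Wd ->
  inGamma beta ->
  banded L beta alpha ->
  exists eps0 : R, 0 < eps0 /\
  exists (lam : R -> 'I_N -> R[i]) (fe : R -> 'I_N -> 'cV[R[i]]_N),
    (* (1) eigenfunctions of P_eps of the form f(j) e^{2 pi i k x} *)
    (forall eps : R, 0 < eps < eps0 ->
       injective (lam eps) /\
       forall l : 'I_N,
         [/\ fe eps l != 0,
             Dmx k alpha *m mxC (Weps Wd eps) *m fe eps l
               = lam eps l *: fe eps l &
             forall (j : 'I_N) (x : R),
               Ptrans alpha (Weps Wd eps) (Ffun k (fe eps l)) j x
                 = lam eps l * Ffun k (fe eps l) j x]) /\
    (* (2) labelling of the eigenvalues *)
    (forall l : 'I_N, cvg0plus (fun eps => lam eps l) (ephase k (alpha l))) /\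
    exists f : 'I_N -> 'cV[R[i]]_N,
      [/\ orthonormalC f,
          (forall l : 'I_N,
             proj_opnorm_cvg (fun eps => Ffun k (fe eps l)) (Ffun k (f l))),
          ((S == 1%N) || (k == 0) ->
             forall l : 'I_N, is_eigvec (mxC Wd) (f l)) &
          ((1 < S)%N && (k != 0) ->
             (forall l : 'I_N, is_eigvec (Dmx k alpha *m mxC (hatW L Wd)) (f l))
             /\ forall (s : 'I_S) (l : 'I_N), inB L s l ->
                  forall j : 'I_N, f l j ord0 != 0 -> inB L s j)].
Proof.
move=> N_gt0 _ L_band [Wd_sym _ _ Wd_eig blocks_eig] beta_in alpha_banded.
(* When all phases agree, the diagonal matrix is scalar and the eigenbasis of [Wd] itself is
   used. *)
have [trivial_phase|] := boolP ((S == 1%N) || (k == 0)).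
  have same_phase i j : ephase k (alpha i) = ephase k (alpha j).
    have [S1|k0] := orP trivial_phase; last first.
      by rewrite /ephase (eqP k0) !mulr0 !mul0r.
    have [s si] := inB_exists L_band i; have [t tj] := inB_exists L_band j.
    have st : s = t.
      apply: val_inj; have := ltn_ord s; have := ltn_ord t.
      by case: (s) (t) => a ? [b ?] /=; rewrite (eqP S1) !ltnS !leqn0 => /eqP-> /eqP->.
    by rewrite (alpha_banded _ _ si) (alpha_banded _ _ tj) st.
  have [e [u [e_inj u_eig u_on]]] := symmetric_eigenbasis Wd_sym Wd_eig.
  have [|||||eps0 [eps0_gt0 [lam [fe [H1 [H2 H3]]]]]] :=
    @perturbed_eigenvectors R N alpha k Wd e u u_on => //.
  - by move=> l j _; rewrite u_eig mxE.
  - by move=> l m _; exact: e_inj.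
  exists eps0; split=> //; exists lam, fe; split=> //; split=> //.
  have f_on := eigenbasis_orthonormal u_on.
  exists (fun l => mxC (u l)^T); split => // [_ l|/andP[S1 k0]].
    by split; [exact: (orthonormalC_neq0 l f_on) | exists (RtoC (e l)); exact: mxC_eigen].
  by move: trivial_phase; rewrite (negPf k0) gtn_eqF.
rewrite negb_or => /andP[S1 k0].
have [e [u [e_inj u_eig u_supp u_on]]] := banded_eigenbasis L_band Wd_sym blocks_eig.
(* As [k] is nonzero and [beta] lies in Gamma, different bands have different phases: the
   eigenspaces of the diagonal matrix are the bands. *)
have same_band s l m : inB L s l ->
    ephase k (alpha m) = ephase k (alpha l) -> inB L s m.
  move=> sl; have [t tm] := inB_exists L_band m.
  rewrite (alpha_banded _ _ sl) (alpha_banded _ _ tm).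
  have [->//|ts] := eqVneq s t; move/eqP.
  by rewrite (negPf (beta_in k t s k0 _)) // eq_sym.
have u_phase l j : u l ord0 j != 0 -> ephase k (alpha j) = ephase k (alpha l).
  have [s sl] := inB_exists L_band l => /(u_supp s l j sl) sj.
  by rewrite (alpha_banded _ _ sl) (alpha_banded _ _ sj).
have [||||eps0 [eps0_gt0 [lam [fe [H1 [H2 H3]]]]]] :=
  @perturbed_eigenvectors R N alpha k Wd e u u_on u_phase => //.
(* On a vector supported in a band, [Wd] and [hatW] agree at the coordinates of that band. *)
- move=> l j; have [s sl] := inB_exists L_band l => /(same_band s l j sl) sj.
  have /rowP/(_ j) := u_eig l; rewrite [RHS]mxE => <-; rewrite !mxE.
  apply: eq_bigr => i _; have [->|/(u_supp s l i sl) si] := eqVneq (u l ord0 i) 0.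
    by rewrite !mul0r.
  by rewrite (inB_hatW Wd j si) sj.
- move=> l m; have [s sl] := inB_exists L_band l => /esym/(same_band s l m sl) sm.
  exact: (e_inj s).
exists eps0; split=> //; exists lam, fe; split=> //; split=> //.
have f_on := eigenbasis_orthonormal u_on.
exists (fun l => mxC (u l)^T); split => //.
move=> _; split=> [l|s l sl j flj]; last first.
  by apply: (u_supp s l j sl); apply: contra_neq flj => ulj; rewrite !mxE ulj.
split; first exact: (orthonormalC_neq0 l f_on).
(* The vector lives in one band, where the diagonal matrix is a scalar, so the two eigenvalues
   multiply. *)
exists (RtoC (e l) * ephase k (alpha l)); rewrite -mulmxA.
rewrite (mxC_eigen (hatW_sym L Wd_sym) (u_eig l)) -scalemxAr -scalerA.
congr (_ *: _); rewrite mul_diag_mx; apply/matrixP => j o; rewrite !mxE (ord1 o).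
by have [->|/u_phase->] := eqVneq (u l ord0 j) 0; rewrite ?mulr0.
Qed.
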